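(* Let $\mathcal{D}$ be a $C^1_c(\mathbb{R}^2)$-stable space of bounded real functions on a nonempty set $X$ and $(\mathcal{E},\mathcal{D})$ a sup-norm-closable bilinear form on which normal contractions operate. Then for every $f\in\mathcal{D}$ the linear functional $L_f(h):=2\mathcal{E}(fh,f)-\mathcal{E}(f^2,h)$, $h\in\mathcal{D}$, is positive and bounded with $\|L_f\|_{\mathcal{D}'}\le 2\mathcal{E}(f)$, and for every normal contraction $F$ one has $L_{F(f)}\le L_f$, i.e. $L_f(h)-L_{F(f)}(h)\ge0$ for all $h\in\mathcal{D}^+$.
   Context: $\|\cdot\|_{\sup}$ is the supremum norm, $\|L\|_{\mathcal{D}'}=\sup\{|L(h)|:h\in\mathcal{D},\|h\|_{\sup}\le1\}$, $\mathcal{D}^+$ the nonnegative elements. A bilinear form is a symmetric nonnegative definite bilinear map $\mathcal{E}:\mathcal{D}\times\mathcal{D}\to\mathbb{R}$, $\mathcal{E}(f):=\mathcal{E}(f,f)$. A normal contraction is $F:\mathbb{R}\to\mathbb{R}$ with $F(0)=0$ and $|F(x)-F(y)|\le|x-y|$; normal contractions operate on $(\mathcal{E},\mathcal{D})$ if $F(f)\in\mathcal{D}$ and $\mathcal{E}(F(f))\le\mathcal{E}(f)$ for all $f$, $F$ (this makes $\mathcal{D}$ an algebra). Sup-norm-closable: every $\mathcal{E}$-Cauchy $(f_n)\subset\mathcal{D}$ with $\|f_n\|_{\sup}\to0$ has $\mathcal{E}(f_n)\to0$. $\mathcal{D}$ is $C^1_c(\mathbb{R}^2)$-stable if $\varphi(f,g)\in\mathcal{D}$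 for all $f,g\in\mathcal{D}$ and all compactly supported $C^1$ functions $\varphi$ on $\mathbb{R}^2$ with $\varphi(0)=0$. A linear functional $L$ is positive if $h\ge0$ implies $L(h)\ge0$. *)

(* Defs.v *)
From Stdlib Require Import Reals.
Open Scope R_scope.

Section Defs.
Variable X : Type.

Definition bounded (f : X -> R) : Prop := exists M, forall x, Rabs (f x) <= M.

Definition bounded_function_space (D : (X -> R) -> Prop) : Prop :=
  (forall f, D f -> bounded f) /\
  D (fun _ => 0) /\
  (forall f g, D f -> D g -> D (fun x => f x + g x)) /\
  (forall (a : R) f, D f -> D (fun x => a * f x)).

Definition bilinear_form (D : (X -> R) -> Prop) (E : (X -> R) -> (X -> R) -> R) : Prop :=
  (forall f g, D f -> D g -> E f g = E g f) /\
  (forall f g h, D f -> D g -> D h -> E (fun x => f x + g x) h = E f h + E g h) /\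
  (forall (a : R) f h, D f -> D h -> E (fun x => a * f x) h = a * E f h) /\
  (forall f, D f -> 0 <= E f f).

Definition normal_contraction (F : R -> R) : Prop :=
  F 0 = 0 /\ forall x y, Rabs (F x - F y) <= Rabs (x - y).

Definition contractions_operate (D : (X -> R) -> Prop) (E : (X -> R) -> (X -> R) -> R) : Prop :=
  forall F f, normal_contraction F -> D f ->
    D (fun x => F (f x)) /\ E (fun x => F (f x)) (fun x => F (f x)) <= E f f.

Definition sup_norm_closable (D : (X -> R) -> Prop) (E : (X -> R) -> (X -> R) -> R) : Prop :=
  forall fn : nat -> X -> R,
    (forall n, D (fn n)) ->
    (forall eps, eps > 0 -> exists N : nat, forall m n, (m >= N)%nat -> (n >= N)%nat ->
        E (fun x => fn n x - fn m x) (fun x => fn n x - fn m x) < eps) ->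
    (forall eps, eps > 0 -> exists N : nat, forall n, (n >= N)%nat ->
        forall x, Rabs (fn n x) <= eps) ->
    Un_cv (fun n => E (fn n) (fn n)) 0.
End Defs.

Definition jointly_continuous (g : R -> R -> R) : Prop :=
  forall x y eps, eps > 0 -> exists delta, delta > 0 /\
    forall x' y', Rabs (x' - x) < delta -> Rabs (y' - y) < delta ->
      Rabs (g x' y' - g x y) < eps.

Definition C1_R2 (phi : R -> R -> R) : Prop :=
  exists d1 d2 : R -> R -> R,
    jointly_continuous d1 /\ jointly_continuous d2 /\
    forall x y eps, eps > 0 -> exists delta, delta > 0 /\
      forall a b, Rabs a < delta -> Rabs b < delta ->
        Rabs (phi (x + a) (y + b) - phi x y - d1 x y * a - d2 x y * b)
          <= eps * (Rabs a + Rabs b).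

Definition compact_support_R2 (phi : R -> R -> R) : Prop :=
  exists M, forall x y, (Rabs x > M \/ Rabs y > M) -> phi x y = 0.

Definition C1c_stable {X : Type} (D : (X -> R) -> Prop) : Prop :=
  forall phi f g, C1_R2 phi -> compact_support_R2 phi -> phi 0 0 = 0 ->
    D f -> D g -> D (fun x => phi (f x) (g x)).

Definition Lf {X : Type} (E : (X -> R) -> (X -> R) -> R) (f h : X -> R) : R :=
  2 * E (fun x => f x * h x) f - E (fun x => f x * f x) h.

(* Main.v *)
(* Closability makes [E] lower semicontinuous for the sup-norm, so by Hahn-Banach there is,
   for finitely many [f] in [D], a positive linear functional [m] on the bounded functions
   with [E g + m ((f - g)^2) >= E f - eps] for all [g] in [D].  The Moreau-Yosida
   regularization [u |-> inf_g (E g + m ((u - g)^2))] is a quadratic form on all bounded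
   functions on which normal contractions operate, is continuous for the sup-norm, lies below
   [E] on [D] and is [eps]-close to [E] at the given [f].  For such a form step functions
   suffice, and there the functional has the explicit Beurling-Deny expression
   [L_f(h) = sum_ij c_ij (f_i - f_j)^2 (h_i + h_j) + sum_i k_i f_i^2 h_i] with
   [c_ij, k_i >= 0], from which all assertions can be read off. *)
From Stdlib Require Import Reals ZArith Lra Lia List ClassicalEpsilon FunctionalExtensionality.
From mathcomp Require boolp classical_sets.
Require Import Defs.
Open Scope R_scope.

(** This is why forms [B] on all bounded functions enter. As [X] carries neither a topology nor a
    sigma-algebra, the functional [m] behind [B] is only finitely additive and is obtained from a
    minimal sublinear functional. No single [B] approximates [E] everywhere, and none has to:
    [L_f(h)] evaluates [E] only at the four functions [f h], [f], [f^2], [h]. Since [E - B] is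
    nonnegative on [D], smallness of its diagonal values at these four functions controls the mixed
    values as well. So [B] may be chosen anew for each [f], [h] and [eps], and no limit of forms is
    taken. *)

Ltac fext := apply functional_extensionality; intro; cbv beta; try unfold Rdiv; ring.

(** * Infima *)

Definition is_glb (S : R -> Prop) (l : R) : Prop :=
  (forall s, S s -> l <= s) /\ (forall l', (forall s, S s -> l' <= s) -> l' <= l).

(** A total function by choice; its value is meaningful only for an inhabited set that is bounded
    below. *)
Definition Glb (S : R -> Prop) : R := epsilon (inhabits 0) (is_glb S).

Lemma Glb_is_glb (S : R -> Prop) b s :
  S s -> (forall s, S s -> b <= s) -> is_glb S (Glb S).
Proof.
  intros Hs Hb. unfold Glb. apply epsilon_spec.
  destruct (completeness (fun y => S (- y))) as [l [Hl1 Hl2]].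
  - exists (- b). intros y Hy. specialize (Hb _ Hy). lra.
  - exists (- s). rewrite Ropp_involutive. exact Hs.
  - exists (- l). split.
    + intros t Ht. assert (- t <= l); [|lra].
      apply Hl1. rewrite Ropp_involutive. exact Ht.
    + intros l' Hl'. assert (l <= - l'); [|lra].
      apply Hl2. intros y Hy. specialize (Hl' _ Hy). lra.
Qed.

Lemma is_glb_le S l s : is_glb S l -> S s -> l <= s.
Proof. intros H Hs. apply H, Hs. Qed.

Lemma is_glb_approx S l e : is_glb S l -> 0 < e -> exists s, S s /\ s < l + e.
Proof.
  intros H He. apply NNPP. intros Hn.
  assert (l + e <= l); [|lra].
  apply H. intros s Hs. apply Rnot_lt_le. intros Hlt. apply Hn. exists s. auto.
Qed.

Lemma Rabs_le_inv a b : Rabs a <= b -> - b <= a <= b.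
Proof.
  intros H. pose proof (Rle_abs a). pose proof (Rle_abs (- a)). rewrite Rabs_Ropp in *. lra.
Qed.

(** The restriction [e < 1] lets an error of size [e] be absorbed into a fixed bound before [e]
    tends to 0. *)
Lemma le_epsilon_mult K a b : (forall e, 0 < e < 1 -> a <= b + K * e) -> a <= b.
Proof.
  intros H. apply Rnot_lt_le. intros Hlt.
  pose (e := Rmin (1 / 2) ((a - b) / (2 * (Rabs K + 1)))).
  pose proof (Rabs_pos K) as HK.
  assert (0 < (a - b) / (2 * (Rabs K + 1))) by (apply Rdiv_lt_0_compat; lra).
  assert (He : 0 < e < 1).
  { split. apply Rmin_pos; lra. apply Rle_lt_trans with (1 / 2). apply Rmin_l. lra. }
  specialize (H e He).
  assert (He2 : e * (2 * (Rabs K + 1)) <= a - b).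
  { apply Rle_trans with ((a - b) / (2 * (Rabs K + 1)) * (2 * (Rabs K + 1))).
    - apply Rmult_le_compat_r. lra. apply Rmin_r.
    - right. field. lra. }
  pose proof (Rle_abs K). nra.
Qed.

(** * Bounded functions and the Hahn-Banach theorem *)

Section BoundedFunctions.
Context {X : Type}.
Implicit Types u v w : X -> R.

Lemma bounded_const c : bounded X (fun _ => c).
Proof. exists (Rabs c). intros _. lra. Qed.

Lemma bounded_add u v : bounded X u -> bounded X v -> bounded X (fun x => u x + v x).
Proof.
  intros [M HM] [N HN]. exists (M + N). intros x.
  pose proof (Rabs_triang (u x) (v x)). specialize (HM x). specialize (HN x). lra.
Qed.

Lemma bounded_mult u v : bounded X u -> bounded X v -> bounded X (fun x => u x * v x).
Proof.
  intros [M HM] [N HN]. exists (M * N). intros x. rewrite Rabs_mult.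
  apply Rmult_le_compat; auto using Rabs_pos.
Qed.

Lemma bounded_scal a u : bounded X u -> bounded X (fun x => a * u x).
Proof. apply bounded_mult, bounded_const. Qed.

Lemma bounded_opp u : bounded X u -> bounded X (fun x => - u x).
Proof. intros [M HM]. exists M. intros x. rewrite Rabs_Ropp. auto. Qed.

Lemma bounded_sub u v : bounded X u -> bounded X v -> bounded X (fun x => u x - v x).
Proof. intros Hu Hv. apply (bounded_add u (fun x => - v x)); auto using bounded_opp. Qed.

Lemma normal_contraction_abs F x : normal_contraction F -> Rabs (F x) <= Rabs x.
Proof. intros [F0 HF]. specialize (HF x 0). rewrite F0, !Rminus_0_r in HF. exact HF. Qed.

Lemma bounded_contraction F u :
  normal_contraction F -> bounded X u -> bounded X (fun x => F (u x)).
Proof.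
  intros HF [M HM]. exists M. intros x.
  apply Rle_trans with (Rabs (u x)); auto using normal_contraction_abs.
Qed.

Lemma bounded_pos_bound u : bounded X u -> exists M, 0 < M /\ forall x, Rabs (u x) <= M.
Proof.
  intros [M HM]. exists (Rmax M 1). split.
  - pose proof (Rmax_r M 1). lra.
  - intros x. apply Rle_trans with M; auto. apply Rmax_l.
Qed.

Lemma bounded_function_space_bounded : bounded_function_space X (bounded X).
Proof. repeat split; auto using bounded_const, bounded_add, bounded_scal. Qed.

(** Homogeneity is asked only as an inequality, because its instance for [/ t] supplies the
    converse. *)
Definition sublinear (p : (X -> R) -> R) : Prop :=
  (forall u v, bounded X u -> bounded X v -> p (fun x => u x + v x) <= p u + p v) /\
  p (fun _ => 0) = 0 /\
  (forall t u, 0 < t -> bounded X u -> p (fun x => t * u x) <= t * p u).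

Definition linear (m : (X -> R) -> R) : Prop :=
  (forall u v, bounded X u -> bounded X v -> m (fun x => u x + v x) = m u + m v) /\
  (forall a u, bounded X u -> m (fun x => a * u x) = a * m u).

Lemma sublinear_scal p t u :
  sublinear p -> 0 <= t -> bounded X u -> p (fun x => t * u x) = t * p u.
Proof.
  intros (_ & p0 & ph) Ht Hu. destruct (Req_dec t 0) as [->|Ht0].
  - rewrite Rmult_0_l. transitivity (p (fun _ => 0)); auto. f_equal. fext.
  - apply Rle_antisym. apply ph; auto; lra.
    assert (H : p u <= / t * p (fun x => t * u x)).
    { replace u with (fun x => / t * (t * u x)) at 1.
      - apply (ph (/ t) (fun x => t * u x)). apply Rinv_0_lt_compat; lra.
        now apply bounded_scal.
      - apply functional_extensionality. intro. now field. }
    apply Rmult_le_compat_l with (r := t) in H; auto.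
    rewrite <- Rmult_assoc, Rinv_r, Rmult_1_l in H; auto.
Qed.

Lemma sublinear_opp p u : sublinear p -> bounded X u -> - p (fun x => - u x) <= p u.
Proof.
  intros (pa & p0 & _) Hu.
  pose proof (pa u (fun x => - u x) Hu (bounded_opp _ Hu)) as H. cbv beta in H.
  replace (fun x => u x + - u x) with (fun _ : X => 0) in H by fext.
  rewrite p0 in H. lra.
Qed.

(** Functionals are total on all functions but compared only on bounded ones, so this is a preorder
    and not an order. *)
Definition le_on_bounded (p q : (X -> R) -> R) : Prop := forall u, bounded X u -> p u <= q u.

Definition inf_of (A : ((X -> R) -> R) -> Prop) (u : X -> R) : R :=
  Glb (fun r => exists p, A p /\ r = p u).

(** Any [p] below [p0] satisfies [p u >= - p (- u) >= - p0 (- u)], so the infimum is finite. For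
    subadditivity, take nearly optimal members at [u] and at [v]; the smaller of the two is nearly
    optimal at both. *)
Lemma inf_chain_sublinear (A : ((X -> R) -> R) -> Prop) p0 :
  (exists p, A p) ->
  (forall p, A p -> sublinear p /\ le_on_bounded p p0) ->
  (forall p q, A p -> A q -> le_on_bounded p q \/ le_on_bounded q p) ->
  sublinear (inf_of A) /\ forall p, A p -> le_on_bounded (inf_of A) p.
Proof.
  intros [p1 Hp1] HA Htot.
  assert (G : forall u, bounded X u -> is_glb (fun r => exists p, A p /\ r = p u) (inf_of A u)).
  { intros u Hu. apply Glb_is_glb with (b := - p0 (fun x => - u x)) (s := p1 u).
    - now exists p1.
    - intros r (p & Hp & ->). destruct (HA p Hp) as [Hs Hle].
      pose proof (sublinear_opp p u Hs Hu).
      pose proof (Hle _ (bounded_opp _ Hu)). lra. }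
  assert (L : forall p, A p -> le_on_bounded (inf_of A) p).
  { intros p Hp u Hu. apply (is_glb_le _ _ _ (G u Hu)). now exists p. }
  split; [|exact L].
  split; [|split].
  - intros u v Hu Hv. apply (le_epsilon_mult 2). intros e [He _].
    destruct (is_glb_approx _ _ e (G u Hu) He) as (r & (p & Hp & ->) & Hpu).
    destruct (is_glb_approx _ _ e (G v Hv) He) as (r & (q & Hq & ->) & Hqv).
    assert (Hex : exists s, A s /\ s u <= p u /\ s v <= q v).
    { destruct (Htot p q Hp Hq) as [H|H]; [exists p|exists q]; repeat split; auto; lra. }
    destruct Hex as (s & Hs & Hsu & Hsv).
    pose proof (L s Hs _ (bounded_add _ _ Hu Hv)).
    pose proof (proj1 (proj1 (HA s Hs)) u v Hu Hv). lra.
  - pose proof (bounded_const 0) as H0. apply Rle_antisym.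
    + pose proof (L p1 Hp1 _ H0). rewrite (proj1 (proj2 (proj1 (HA p1 Hp1)))) in H. exact H.
    + apply (G _ H0). intros r (p & Hp & ->). right. symmetry. apply (HA p Hp).
  - intros t u Ht Hu. apply (le_epsilon_mult t). intros e [He _].
    destruct (is_glb_approx _ _ e (G u Hu) He) as (r & (p & Hp & ->) & Hpu).
    pose proof (L p Hp _ (bounded_scal t _ Hu)).
    rewrite (sublinear_scal p t u (proj1 (HA p Hp))) in H; auto; [|lra]. nra.
Qed.

(** Finite because [t p(w) = p(t w) <= p(v + t w) + p(- v)]. The parameter [t = 0] puts it below
    [p], and [t = 1] below [p(v + w) - p(w)]; for a minimal [p] these two facts yield
    [p(v) + p(w) <= p(v + w)]. *)
Definition directional_inf (p : (X -> R) -> R) w v : R :=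
  Glb (fun r => exists t, 0 <= t /\ r = p (fun x => v x + t * w x) - t * p w).

Lemma directional_inf_sublinear p w :
  sublinear p -> bounded X w ->
  sublinear (directional_inf p w) /\
  forall v t, bounded X v -> 0 <= t ->
    directional_inf p w v <= p (fun x => v x + t * w x) - t * p w.
Proof.
  intros Hp Hw.
  assert (G : forall v, bounded X v ->
    is_glb (fun r => exists t, 0 <= t /\ r = p (fun x => v x + t * w x) - t * p w)
      (directional_inf p w v)).
  { intros v Hv.
    apply Glb_is_glb with (b := - p (fun x => - v x)) (s := p (fun x => v x + 0 * w x) - 0 * p w).
    - exists 0. split; [lra|reflexivity].
    - intros r (t & Ht & ->). rewrite <- (sublinear_scal p t w Hp Ht Hw).
      assert (Hb : bounded X (fun x => v x + t * w x)) by auto using bounded_add, bounded_scal.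
      pose proof (proj1 Hp _ _ Hb (bounded_opp _ Hv)) as H. cbv beta in H.
      replace (fun x => v x + t * w x + - v x) with (fun x => t * w x) in H by fext. lra. }
  assert (L : forall v t, bounded X v -> 0 <= t ->
    directional_inf p w v <= p (fun x => v x + t * w x) - t * p w).
  { intros v t Hv Ht. apply (is_glb_le _ _ _ (G v Hv)). now exists t. }
  split; [|exact L].
  split; [|split].
  - intros u v Hu Hv. apply (le_epsilon_mult 2). intros e [He _].
    destruct (is_glb_approx _ _ e (G u Hu) He) as (r & (s & Hs & ->) & Hpu).
    destruct (is_glb_approx _ _ e (G v Hv) He) as (r & (t & Ht & ->) & Hpv).
    pose proof (L _ (s + t) (bounded_add _ _ Hu Hv) ltac:(lra)) as H.
    pose proof (proj1 Hp (fun x => u x + s * w x) (fun x => v x + t * w x)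
      ltac:(auto using bounded_add, bounded_scal) ltac:(auto using bounded_add, bounded_scal)) as H2.
    cbv beta in H, H2.
    replace (fun x => u x + s * w x + (v x + t * w x))
      with (fun x => u x + v x + (s + t) * w x) in H2 by fext. lra.
  - pose proof (bounded_const 0) as H0. apply Rle_antisym.
    + pose proof (L _ 0 H0 ltac:(lra)) as H. cbv beta in H.
      replace (fun x => 0 + 0 * w x) with (fun _ : X => 0) in H by fext.
      rewrite (proj1 (proj2 Hp)) in H. lra.
    + apply (G _ H0). intros r (t & Ht & ->).
      rewrite <- (sublinear_scal p t w Hp Ht Hw).
      replace (fun x => 0 + t * w x) with (fun x => t * w x) by fext. lra.
  - intros s u Hs Hu. apply (le_epsilon_mult s). intros e [He _].
    destruct (is_glb_approx _ _ e (G u Hu) He) as (r & (t & Ht & ->) & Hpu).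
    pose proof (L _ (s * t) (bounded_scal s _ Hu) ltac:(nra)) as H. cbv beta in H.
    replace (fun x => s * u x + s * t * w x) with (fun x => s * (u x + t * w x)) in H by fext.
    assert (Hb : bounded X (fun x => u x + t * w x)) by auto using bounded_add, bounded_scal.
    rewrite (sublinear_scal p s _ Hp ltac:(lra) Hb) in H. nra.
Qed.

(* A pointwise minimal sublinear functional coincides with each of its directional infima,
   which makes it additive. *)
Theorem linear_below_sublinear p0 : sublinear p0 -> exists m, linear m /\ le_on_bounded m p0.
Proof.
  intros Hp0.
  pose (T := {p | sublinear p /\ le_on_bounded p p0}).
  assert (t0 : T) by (exists p0; split; [exact Hp0|intros u _; lra]).
  (* The relation is reversed, so that the maximal element given by Zorn's lemma is a minimal
     functional; [t0] bounds the empty chain. *)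
  destruct (@classical_sets.ZL_preorder T t0
    (fun s t : T => boolp.asbool (le_on_bounded (proj1_sig t) (proj1_sig s))))
    as [[p [Hp Hle]] Hmin].
  - intros s. apply boolp.asboolT. intros u _. lra.
  - intros r s t Hrs Hst. apply boolp.asboolW in Hrs, Hst. apply boolp.asboolT.
    intros u Hu. specialize (Hrs u Hu). specialize (Hst u Hu). lra.
  - intros A HA. destruct (classic (exists s, A s)) as [[s0 Hs0]|Hn].
    2: { exists t0. intros s Hs. elim Hn. now exists s. }
    pose (A' := fun p => exists s : T, A s /\ p = proj1_sig s).
    destruct (inf_chain_sublinear A' p0) as [HI HL].
    + exists (proj1_sig s0). now exists s0.
    + intros p (s & _ & ->). exact (proj2_sig s).
    + intros p q (s & Hs & ->) (t & Ht & ->).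
      destruct (HA s t Hs Ht) as [H|H]; apply boolp.asboolW in H; auto.
    + assert (HI0 : le_on_bounded (inf_of A') p0).
      { intros u Hu. apply Rle_trans with (proj1_sig s0 u).
        - apply HL; auto. now exists s0.
        - apply (proj2 (proj2_sig s0)); auto. }
      exists (exist _ (inf_of A') (conj HI HI0)). intros s Hs. apply boolp.asboolT.
      apply HL. now exists s.
  - assert (Hminp : forall q, sublinear q -> le_on_bounded q p -> le_on_bounded p q).
    { intros q Hq Hqp.
      assert (Hq0 : le_on_bounded q p0).
      { intros u Hu. pose proof (Hqp u Hu). pose proof (Hle u Hu). lra. }
      specialize (Hmin (exist _ q (conj Hq Hq0))).
      apply boolp.asboolW, Hmin, boolp.asboolT, Hqp. }
    assert (Hadd : forall u v, bounded X u -> bounded X v -> p (fun x => u x + v x) = p u + p v).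
    { intros u v Hu Hv. apply Rle_antisym. now apply Hp.
      destruct (directional_inf_sublinear p v Hp Hv) as [Hs HL].
      assert (H : le_on_bounded p (directional_inf p v)).
      { apply Hminp; auto. intros w Hw. pose proof (HL w 0 Hw ltac:(lra)) as H.
        replace (fun x => w x + 0 * v x) with w in H by fext. lra. }
      specialize (H u Hu). pose proof (HL u 1 Hu ltac:(lra)) as H1.
      replace (fun x => u x + 1 * v x) with (fun x => u x + v x) in H1 by fext. lra. }
    assert (Hopp : forall u, bounded X u -> p (fun x => - u x) = - p u).
    { intros u Hu. pose proof (Hadd u _ Hu (bounded_opp _ Hu)) as H. cbv beta in H.
      replace (fun x => u x + - u x) with (fun _ : X => 0) in H by fext.
      rewrite (proj1 (proj2 Hp)) in H. lra. }
    exists p. split; [split|]; auto.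
    intros a u Hu. destruct (Rle_lt_dec 0 a) as [Ha|Ha].
    + now apply sublinear_scal.
    + replace (fun x => a * u x) with (fun x => - (- a * u x)) by fext.
      rewrite Hopp by now apply bounded_scal.
      rewrite (sublinear_scal p (- a) u Hp); auto; lra.
Qed.

Definition positive (m : (X -> R) -> R) : Prop :=
  forall u, bounded X u -> (forall x, 0 <= u x) -> 0 <= m u.

Lemma linear_sub m u v : linear m -> bounded X u -> bounded X v ->
  m (fun x => u x - v x) = m u - m v.
Proof.
  intros [Ha Hs] Hu Hv.
  replace (fun x => u x - v x) with (fun x => u x + -1 * v x) by fext.
  rewrite (Ha u (fun x => -1 * v x)), Hs; auto using bounded_scal. ring.
Qed.

Lemma positive_le m u v : linear m -> positive m -> bounded X u -> bounded X v ->
  (forall x, u x <= v x) -> m u <= m v.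
Proof.
  intros Hm Hp Hu Hv H.
  assert (0 <= m (fun x => v x - u x)).
  { apply Hp; auto using bounded_sub. intros x. specialize (H x). lra. }
  rewrite linear_sub in H0; auto. lra.
Qed.

End BoundedFunctions.
(** * Bilinear forms *)

Section BilinearForms.
Context {X : Type} {D : (X -> R) -> Prop} {E : (X -> R) -> (X -> R) -> R}.
Hypothesis HD : bounded_function_space X D.
Hypothesis HE : bilinear_form X D E.
Implicit Types u v w f g h : X -> R.

Lemma space_bounded u : D u -> bounded X u.
Proof. apply HD. Qed.

Lemma space_zero : D (fun _ => 0).
Proof. apply HD. Qed.

Lemma space_add u v : D u -> D v -> D (fun x => u x + v x).
Proof. apply HD. Qed.

Lemma space_scal a u : D u -> D (fun x => a * u x).
Proof. apply HD. Qed.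

Lemma space_sub u v : D u -> D v -> D (fun x => u x - v x).
Proof.
  intros Hu Hv. replace (fun x => u x - v x) with (fun x => u x + -1 * v x) by fext.
  apply (space_add u (fun x => -1 * v x)); auto using space_scal.
Qed.

Lemma form_sym u v : D u -> D v -> E u v = E v u.
Proof. apply HE. Qed.

Lemma form_addl u v w : D u -> D v -> D w -> E (fun x => u x + v x) w = E u w + E v w.
Proof. apply HE. Qed.

Lemma form_scall a u w : D u -> D w -> E (fun x => a * u x) w = a * E u w.
Proof. apply HE. Qed.

Lemma form_ge0 u : D u -> 0 <= E u u.
Proof. apply HE. Qed.

Lemma form_subl u v w : D u -> D v -> D w -> E (fun x => u x - v x) w = E u w - E v w.
Proof.
  intros Hu Hv Hw. replace (fun x => u x - v x) with (fun x => u x + -1 * v x) by fext.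
  rewrite (form_addl u (fun x => -1 * v x)), form_scall; auto using space_scal. ring.
Qed.

Lemma form_zerol u : D u -> E (fun _ => 0) u = 0.
Proof.
  intros Hu. replace (fun _ : X => 0) with (fun x => u x - u x) by fext.
  rewrite form_subl; auto. ring.
Qed.

Lemma form_addr u v w : D u -> D v -> D w -> E u (fun x => v x + w x) = E u v + E u w.
Proof.
  intros Hu Hv Hw. rewrite form_sym, form_addl; auto using space_add.
  rewrite (form_sym v), (form_sym w); auto.
Qed.

Lemma form_subr u v w : D u -> D v -> D w -> E u (fun x => v x - w x) = E u v - E u w.
Proof.
  intros Hu Hv Hw. rewrite form_sym, form_subl; auto using space_sub.
  rewrite (form_sym v), (form_sym w); auto.
Qed.

Lemma form_scalr a u w : D u -> D w -> E u (fun x => a * w x) = a * E u w.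
Proof.
  intros Hu Hw. rewrite form_sym, form_scall; auto using space_scal.
  rewrite (form_sym w); auto.
Qed.

Lemma quad_scal a u : D u -> E (fun x => a * u x) (fun x => a * u x) = a * a * E u u.
Proof. intros Hu. rewrite form_scall, form_scalr; auto using space_scal. ring. Qed.

Lemma quad_add u v : D u -> D v ->
  E (fun x => u x + v x) (fun x => u x + v x) = E u u + 2 * E u v + E v v.
Proof.
  intros Hu Hv. rewrite form_addl, !form_addr; auto using space_add.
  rewrite (form_sym v u); auto. ring.
Qed.

Lemma quad_sub u v : D u -> D v ->
  E (fun x => u x - v x) (fun x => u x - v x) = E u u - 2 * E u v + E v v.
Proof.
  intros Hu Hv. rewrite form_subl, !form_subr; auto using space_sub.
  rewrite (form_sym v u); auto. ring.
Qed.

(** Nonnegativity at [u + v] and [u - v]. This root-free substitute for Cauchy-Schwarz controls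
    mixed values by diagonal ones, here and for [E - B]. *)
Lemma form_abs_le u v : D u -> D v -> Rabs (E u v) <= (E u u + E v v) / 2.
Proof.
  intros Hu Hv.
  pose proof (form_ge0 _ (space_add _ _ Hu Hv)) as H1. rewrite quad_add in H1; auto.
  pose proof (form_ge0 _ (space_sub _ _ Hu Hv)) as H2. rewrite quad_sub in H2; auto.
  apply Rabs_le. lra.
Qed.

(** The gap between the two sides is [a (1 - a) E(u - v)]. *)
Lemma quad_convex a u v : D u -> D v -> 0 <= a <= 1 ->
  E (fun x => a * u x + (1 - a) * v x) (fun x => a * u x + (1 - a) * v x)
    <= a * E u u + (1 - a) * E v v.
Proof.
  intros Hu Hv Ha.
  rewrite (quad_add (fun x => a * u x) (fun x => (1 - a) * v x)); auto using space_scal.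
  rewrite !quad_scal, form_scall, form_scalr; auto using space_scal.
  pose proof (form_ge0 _ (space_sub _ _ Hu Hv)) as H2. rewrite quad_sub in H2; auto.
  assert (0 <= a * (1 - a)) by nra. nra.
Qed.

(** * Lower semicontinuity *)

Hypothesis Hclos : sup_norm_closable X D E.

(* Otherwise pick near-minimisers of the form over the convex sets of [g] at distance
   [1/(n+1)] from [f]; by the parallelogram law they form a Cauchy sequence, and
   closability makes their energies converge to that of [f]. *)
Lemma form_lsc f eps : D f -> 0 < eps ->
  exists delta, 0 < delta /\
    forall g, D g -> (forall x, Rabs (f x - g x) <= delta) -> E f f - eps < E g g.
Proof.
  intros Hf Heps. apply NNPP. intros Hn.
  pose (C := fun n g => D g /\ (forall x, Rabs (f x - g x) <= / INR (S n)) /\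
                        E g g <= E f f - eps).
  assert (Hpos : forall n, 0 < / INR (S n)).
  { intros n. apply Rinv_0_lt_compat, lt_0_INR. lia. }
  assert (Hinv : forall n m, (n <= m)%nat -> / INR (S m) <= / INR (S n)).
  { intros n m Hnm. apply Rinv_le_contravar. apply lt_0_INR; lia. apply le_INR; lia. }
  assert (HC : forall n, exists g, C n g).
  { intros n. apply NNPP. intros Hc. apply Hn. exists (/ INR (S n)). split; auto.
    intros g Hg Hfg. apply Rnot_le_lt. intros Hle. apply Hc. exists g. repeat split; auto. }
  assert (Cmono : forall n m g, (n <= m)%nat -> C m g -> C n g).
  { intros n m g Hnm (Hg & Hfg & Hle). repeat split; auto.
    intros x. apply Rle_trans with (/ INR (S m)); auto. }
  (* The sets [C n] shrink, so their minimal energies [d n] increase; they stay below [E f f] and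
     therefore converge. *)
  pose (d := fun n => Glb (fun r => exists g, C n g /\ r = E g g)).
  assert (G : forall n, is_glb (fun r => exists g, C n g /\ r = E g g) (d n)).
  { intros n. destruct (HC n) as [g Hg].
    apply Glb_is_glb with (b := 0) (s := E g g). now exists g.
    intros r (k & (Hk & _) & ->). now apply form_ge0. }
  assert (Hg : forall n, exists g, C n g /\ E g g < d n + / INR (S n)).
  { intros n. destruct (is_glb_approx _ _ _ (G n) (Hpos n)) as (r & (g & Hg & ->) & Hlt).
    now exists g. }
  apply choice in Hg. destruct Hg as [g Hg].
  assert (Hd : forall n m, (n <= m)%nat -> d n <= d m).
  { intros n m Hnm. apply (G m). intros r (k & Hk & ->).
    apply (is_glb_le _ _ _ (G n)). exists k. split; auto. now apply Cmono with m. }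
  assert (Hub : forall n, d n <= E f f).
  { intros n. destruct (HC n) as [k Hk]. apply Rle_trans with (E k k).
    - apply (is_glb_le _ _ _ (G n)). now exists k.
    - destruct Hk as (_ & _ & Hk). lra. }
  destruct (growing_cv d) as [l Hl].
  { intros n. apply Hd. lia. }
  { exists (E f f). intros r (n & ->). apply Hub. }
  assert (Hdl : forall n, d n <= l).
  { intros n. apply growing_ineq; auto. intros k. apply Hd. lia. }
  assert (HDg : forall n, D (g n)) by (intros n; apply Hg).
  assert (Hinv0 : forall eta, 0 < eta -> exists N, / INR (S N) < eta).
  { intros eta Heta. destruct (archimed_cor1 eta Heta) as (N & HN & HN0).
    exists N. apply Rle_lt_trans with (/ INR N); auto.
    apply Rinv_le_contravar. now apply lt_0_INR. apply le_INR. lia. }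
  assert (Hcv : Un_cv (fun n => E (fun x => g n x - f x) (fun x => g n x - f x)) 0).
  { apply (Hclos (fun n x => g n x - f x)).
    - intros n. now apply space_sub.
    - intros eta Heta.
      (* Both energies are below [l + eta / 8], and the midpoint stays in the convex set [C N], so
         its energy exceeds [l - eta / 8]. The parallelogram law weights these by 2, 2 and -4, which
         gives less than [eta]. *)
      destruct (Hinv0 (eta / 8) ltac:(lra)) as (N1 & HN1).
      destruct (Hl (eta / 8) ltac:(lra)) as (N2 & HN2).
      exists (N1 + N2)%nat. intros m n Hm Hn'.
      pose (N := (N1 + N2)%nat).
      replace (fun x => g n x - f x - (g m x - f x)) with (fun x => g n x - g m x) by fext.
      rewrite quad_sub; auto.
      assert (Hmid : C N (fun x => / 2 * (g n x + g m x))).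
      { destruct (Cmono N n (g n) ltac:(lia) (proj1 (Hg n))) as (_ & Hn1 & Hn2).
        destruct (Cmono N m (g m) ltac:(lia) (proj1 (Hg m))) as (_ & Hm1 & Hm2).
        split; [|split].
        - apply (space_scal (/ 2) (fun x => g n x + g m x)). now apply space_add.
        - intros x. replace (f x - / 2 * (g n x + g m x))
            with (/ 2 * (f x - g n x) + / 2 * (f x - g m x)) by field.
          specialize (Hn1 x). specialize (Hm1 x).
          apply Rabs_le. apply Rabs_le_inv in Hn1, Hm1. lra.
        - replace (fun x => / 2 * (g n x + g m x))
            with (fun x => / 2 * g n x + (1 - / 2) * g m x)
            by (apply functional_extensionality; intro; field).
          pose proof (quad_convex (/ 2) (g n) (g m) (HDg n) (HDg m) ltac:(lra)). lra. }
      assert (HdN : d N <= E (fun x => / 2 * (g n x + g m x)) (fun x => / 2 * (g n x + g m x))).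
      { apply (is_glb_le _ _ _ (G N)). now exists (fun x => / 2 * (g n x + g m x)). }
      rewrite (quad_scal (/ 2) (fun x => g n x + g m x)), quad_add in HdN;
        auto using space_add.
      pose proof (proj2 (Hg n)). pose proof (proj2 (Hg m)).
      pose proof (Hdl n). pose proof (Hdl m).
      pose proof (Hinv N1 n ltac:(lia)). pose proof (Hinv N1 m ltac:(lia)).
      assert (l - eta / 8 < d N).
      { specialize (HN2 N ltac:(lia)). unfold Rdist in HN2.
        apply Rabs_def2 in HN2. lra. }
      lra.
    - intros eta Heta. destruct (Hinv0 eta Heta) as (N & HN).
      exists N. intros n Hn' x. rewrite Rabs_minus_sym.
      apply Rle_trans with (/ INR (S n)).
      + apply (Hg n).
      + pose proof (Hinv N n Hn'). lra. }
  pose proof (form_ge0 f Hf) as Hf0.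
  (* With [r = g N - f] one has [E(f) <= (1 + s) E(g N) + (1 + / s) E(r)]. The choice of [s] makes
     [s E(f)] smaller than [eps / 2], with [+ 1] covering [E(f) = 0], and [eta] makes the last term
     at most [eps / 2]; together they contradict [E(g N) <= E(f) - eps]. *)
  pose (s := eps / (2 * (E f f + 1))).
  assert (Hs : 0 < s) by (apply Rdiv_lt_0_compat; lra).
  assert (Hs2 : s * (2 * (E f f + 1)) = eps) by (unfold s; field; lra).
  pose (eta := eps / 2 / (1 + / s)).
  assert (Hs' : 0 < / s) by (now apply Rinv_0_lt_compat).
  assert (Heta : 0 < eta) by (apply Rdiv_lt_0_compat; lra).
  assert (Heta2 : (1 + / s) * eta = eps / 2) by (unfold eta; field; lra).
  destruct (Hcv eta Heta) as (N & HN).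
  specialize (HN N (Nat.le_refl N)). unfold Rdist in HN. apply Rabs_def2 in HN.
  destruct (Hg N) as ((_ & _ & HgN) & _).
  set (r := fun x => g N x - f x) in *.
  assert (Hr : D r) by now apply space_sub.
  assert (Hfr : E f f = E (g N) (g N) - 2 * E (g N) r + E r r).
  { rewrite <- quad_sub; auto. unfold r. f_equal; fext. }
  (* Young: [-2 E(g,r) <= s E(g) + E(r)/s] *)
  pose proof (form_ge0 _ (space_add _ _ (space_scal s _ (HDg N)) Hr)) as Hy. cbv beta in Hy.
  rewrite (quad_add (fun x => s * g N x) r), quad_scal, form_scall in Hy;
    auto using space_scal.
  assert (Hy2 : 0 <= s * E (g N) (g N) + 2 * E (g N) r + / s * E r r).
  { apply Rmult_le_reg_l with s; auto. rewrite Rmult_0_r.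
    replace (s * (s * E (g N) (g N) + 2 * E (g N) r + / s * E r r))
      with (s * s * E (g N) (g N) + 2 * (s * E (g N) r) + E r r) by (field; lra).
    exact Hy. }
  assert (s * E (g N) (g N) <= s * (E f f - eps)) by (apply Rmult_le_compat_l; lra).
  assert ((1 + / s) * E r r <= (1 + / s) * eta) by (apply Rmult_le_compat_l; lra).
  nra.
Qed.

(** * Measures witnessing lower semicontinuity *)

(** Every [g] with [E(g) <= E(f) - eps] is at sup-distance more than [delta] from [f]. These [g]
    form a convex set, so Hahn-Banach turns the varying points where [|f - g| > delta] into one
    positive [m] with [m ((f - g)^2) >= delta^2] for all of them. A multiple of [m] then compensates
    the missing energy. *)
Lemma exists_measure f eps : inhabited X -> D f -> 0 < eps ->
  exists m, linear m /\ positive m /\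
    forall g, D g -> E f f - eps <= E g g + m (fun x => (f x - g x) * (f x - g x)).
Proof.
  intros [x0] Hf Heps.
  (* If [E(f) < eps] the zero functional works; otherwise [g = 0] is admissible, which keeps the
     sets [S w] inhabited. *)
  destruct (Rlt_le_dec (E f f - eps) 0) as [Hneg|Hnn].
  { exists (fun _ => 0). repeat split.
    - intros. lra.
    - intros. lra.
    - intros u _ _. lra.
    - intros g Hg. pose proof (form_ge0 g Hg). lra. }
  destruct (form_lsc f eps Hf Heps) as (delta & Hdelta & Hlsc).
  (* The infimum of [S w] is at most [sup w] and sends [- (f - g)^2] to at most [- delta^2] for
     admissible [g]; any linear functional below it inherits positivity from the first bound and the
     separation from the second. *)
  pose (S := fun w r => exists t g s, 0 <= t /\ D g /\ E g g <= E f f - eps /\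
     (forall x, w x + t * ((f x - g x) * (f x - g x)) <= s) /\ r = s - t * (delta * delta)).
  assert (Hlow : forall w M, (forall x, Rabs (w x) <= M) -> forall r, S w r -> - M <= r).
  { intros w M HM r (t & g & s & Ht & Hg & Hle & Hs & ->).
    assert (Hx : exists x, delta < Rabs (f x - g x)).
    { apply NNPP. intros Hn. assert (H : E f f - eps < E g g); [|lra].
      apply Hlsc; auto. intros x. apply Rnot_lt_le. intros Hx. apply Hn. now exists x. }
    destruct Hx as [x Hx]. specialize (Hs x). specialize (HM x). apply Rabs_le_inv in HM.
    assert (delta * delta <= (f x - g x) * (f x - g x)).
    { rewrite <- (Rabs_pos_eq ((f x - g x) * (f x - g x)) (Rle_0_sqr _)), Rabs_mult.
      apply Rmult_le_compat; lra. }
    assert (t * (delta * delta) <= t * ((f x - g x) * (f x - g x)))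
      by (apply Rmult_le_compat_l; auto). lra. }
  assert (HS : forall w M, (forall x, w x <= M) -> S w M).
  { intros w M HM. exists 0, (fun _ => 0), M. repeat split; try lra.
    - apply space_zero.
    - rewrite form_zerol; auto using space_zero.
    - intros x. rewrite Rmult_0_l, Rplus_0_r. auto. }
  pose (p := fun w => Glb (S w)).
  assert (G : forall w, bounded X w -> is_glb (S w) (p w)).
  { intros w [M HM]. apply Glb_is_glb with (b := - M) (s := M).
    - apply HS. intros x. specialize (HM x). apply Rabs_le_inv in HM. lra.
    - now apply Hlow. }
  assert (Hp : sublinear p).
  { split; [|split].
    - intros u v Hu Hv. apply (le_epsilon_mult 2). intros e [He _].
      destruct (is_glb_approx _ _ e (G u Hu) He)
        as (r1 & (t1 & g1 & s1 & Ht1 & Hg1 & Hle1 & Hs1 & ->) & Hp1).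
      destruct (is_glb_approx _ _ e (G v Hv) He)
        as (r2 & (t2 & g2 & s2 & Ht2 & Hg2 & Hle2 & Hs2 & ->) & Hp2).
      assert (HSS : S (fun x => u x + v x) (s1 + s2 - (t1 + t2) * (delta * delta))).
      (* If both weights vanish, any admissible function serves. Otherwise [g1] and [g2] are mixed
         in proportion to [t1] and [t2]; convexity of [E] keeps the mixture admissible, and
         convexity of the square keeps the constraint. *)
      { destruct (Req_dec (t1 + t2) 0) as [H0|H0].
        - exists 0, g1, (s1 + s2). repeat split; auto; try lra.
          + intros x. specialize (Hs1 x). specialize (Hs2 x).
            replace t1 with 0 in * by lra. replace t2 with 0 in * by lra. lra.
          + rewrite H0. reflexivity.
        - pose (a := t1 / (t1 + t2)).
          assert (Ha1 : a * (t1 + t2) = t1) by (unfold a; field; auto).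
          assert (Ha2 : (1 - a) * (t1 + t2) = t2) by lra.
          assert (Ha0 : 0 <= a) 
            by (apply Rmult_le_pos; [|left; apply Rinv_0_lt_compat]; lra).
          assert (Ha : 0 <= a <= 1) by nra.
          exists (t1 + t2), (fun x => a * g1 x + (1 - a) * g2 x), (s1 + s2).
          repeat split; auto; try lra.
          + apply (space_add (fun x => a * g1 x) (fun x => (1 - a) * g2 x));
              auto using space_scal.
          + pose proof (quad_convex a g1 g2 Hg1 Hg2 Ha). nra.
          + intros x. specialize (Hs1 x). specialize (Hs2 x).
            set (y1 := f x - g1 x) in *. set (y2 := f x - g2 x) in *.
            replace (f x - (a * g1 x + (1 - a) * g2 x)) with (a * y1 + (1 - a) * y2)
              by (unfold y1, y2; ring).
            assert (Hc : (a * y1 + (1 - a) * y2) * (a * y1 + (1 - a) * y2)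
                      <= a * (y1 * y1) + (1 - a) * (y2 * y2)).
            { assert (0 <= a * (1 - a) * ((y1 - y2) * (y1 - y2))).
              { apply Rmult_le_pos; [apply Rmult_le_pos; lra|apply Rle_0_sqr]. } nra. }
            apply Rmult_le_compat_l with (r := t1 + t2) in Hc; [|lra].
            replace ((t1 + t2) * (a * (y1 * y1) + (1 - a) * (y2 * y2)))
              with (t1 * (y1 * y1) + t2 * (y2 * y2)) in Hc by
              (transitivity (a * (t1 + t2) * (y1 * y1) + (1 - a) * (t1 + t2) * (y2 * y2));
               [rewrite Ha1, Ha2; reflexivity|ring]).
            lra. }
      pose proof (is_glb_le _ _ _ (G _ (bounded_add _ _ Hu Hv)) HSS). lra.
    - pose proof (bounded_const (X := X) 0) as H0. apply Rle_antisym.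
      + apply (is_glb_le _ _ _ (G _ H0)). apply HS. intros; lra.
      + apply (G _ H0). intros r Hr. apply (Hlow _ 0) in Hr; try lra.
        intros. rewrite Rabs_R0. lra.
    - intros a u Ha Hu. apply (le_epsilon_mult a). intros e [He _].
      destruct (is_glb_approx _ _ e (G u Hu) He)
        as (r & (t & g & s & Ht & Hg & Hle & Hs & ->) & Hp).
      assert (HSS : S (fun x => a * u x) (a * s - (a * t) * (delta * delta))).
      { exists (a * t), g, (a * s). repeat split; auto. nra.
        intros x. specialize (Hs x). apply Rmult_le_compat_l with (r := a) in Hs; lra. }
      pose proof (is_glb_le _ _ _ (G _ (bounded_scal a _ Hu)) HSS). nra. }
  destruct (linear_below_sublinear p Hp) as (m & Hm & Hmp).
  assert (Hopp : forall u, bounded X u -> m u = - m (fun x => - u x)).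
  { intros u Hu. replace (fun x => - u x) with (fun x => -1 * u x) by fext.
    rewrite (proj2 Hm); auto. ring. }
  assert (Hmpos : positive m).
  { intros u Hu Hu0. rewrite Hopp by auto.
    pose proof (Hmp _ (bounded_opp _ Hu)).
    pose proof (is_glb_le _ _ 0 (G _ (bounded_opp _ Hu))) as H1.
    assert (p (fun x => - u x) <= 0); [|lra].
    apply H1, HS. intros x. specialize (Hu0 x). lra. }
  assert (Hdd : 0 < delta * delta) by (apply Rmult_lt_0_compat; auto).
  (* Scaled so that [c delta^2 = E(f)]: the penalty alone then covers [E(f) - eps] whenever [g] is
     admissible. *)
  pose (c := E f f / (delta * delta)).
  assert (Hc : c * (delta * delta) = E f f) by (unfold c; field; lra).
  assert (Hc0 : 0 <= c) 
    by (apply Rmult_le_pos; [|left; apply Rinv_0_lt_compat]; auto using form_ge0).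
  exists (fun u => c * m u). repeat split.
  - intros u v Hu Hv. rewrite (proj1 Hm); auto. ring.
  - intros a u Hu. rewrite (proj2 Hm); auto. ring.
  - intros u Hu Hu0. apply Rmult_le_pos; auto.
  - intros g Hg.
    assert (Hb : bounded X (fun x => (f x - g x) * (f x - g x))).
    { pose proof (space_bounded _ (space_sub _ _ Hf Hg)) as H. apply (bounded_mult _ _ H H). }
    assert (H0 : 0 <= m (fun x => (f x - g x) * (f x - g x)))
      by (apply Hmpos; auto; intros; apply Rle_0_sqr).
    destruct (Rle_lt_dec (E g g) (E f f - eps)) as [Hle|Hlt].
    + assert (H : delta * delta <= m (fun x => (f x - g x) * (f x - g x))).
      { rewrite Hopp by auto.
        pose proof (Hmp _ (bounded_opp _ Hb)) as H1.
        assert (H2 : p (fun x => - ((f x - g x) * (f x - g x))) <= 0 - 1 * (delta * delta)).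
        { apply (is_glb_le _ _ _ (G _ (bounded_opp _ Hb))).
          exists 1, g, 0. repeat split; auto; try lra. intros x. lra. }
        lra. }
      pose proof (form_ge0 g Hg).
      apply Rmult_le_compat_l with (r := c) in H; auto. lra.
    + assert (0 <= c * m (fun x => (f x - g x) * (f x - g x))) by now apply Rmult_le_pos. lra.
Qed.

(** The functionals for the single members are added; by positivity each extra summand only enlarges
    the right-hand side. *)
Lemma exists_common_measure (l : list (X -> R)) eps : inhabited X -> Forall D l -> 0 < eps ->
  exists m, linear m /\ positive m /\
    forall f g, In f l -> D g -> E f f - eps <= E g g + m (fun x => (f x - g x) * (f x - g x)).
Proof.
  intros HX Hl Heps. induction Hl as [|f l Hf Hl (m & Hm & Hpos & Hml)].
  - exists (fun _ => 0). repeat split.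
    + intros. lra.
    + intros. lra.
    + intros u _ _. lra.
    + intros f g [].
  - destruct (exists_measure f eps HX Hf Heps) as (m' & Hm' & Hpos' & Hmf).
    exists (fun u => m' u + m u). repeat split.
    + intros u v Hu Hv. rewrite (proj1 Hm), (proj1 Hm'); auto. ring.
    + intros a u Hu. rewrite (proj2 Hm), (proj2 Hm'); auto. ring.
    + intros u Hu H. pose proof (Hpos u Hu H). pose proof (Hpos' u Hu H). lra.
    + intros k g Hk Hg.
      assert (Hkl : D k).
      { destruct Hk as [<-|Hk]; auto. rewrite Forall_forall in Hl. auto. }
      assert (Hb : bounded X (fun x => (k x - g x) * (k x - g x))).
      { pose proof (space_bounded _ (space_sub _ _ Hkl Hg)) as H. apply (bounded_mult _ _ H H). }
      assert (H0 : forall x, 0 <= (k x - g x) * (k x - g x)) by (intros; apply Rle_0_sqr).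
      pose proof (Hpos _ Hb H0). pose proof (Hpos' _ Hb H0).
      destruct Hk as [<-|Hk].
      * specialize (Hmf g Hg). lra.
      * specialize (Hml k g Hk Hg). lra.
Qed.

End BilinearForms.
(** * The Jordan-von Neumann theorem *)

(** Subtracting [t phi(1)] leaves an additive function that vanishes on the integers. It is thus
    determined by the fractional part, hence bounded, and a bounded additive function is zero. *)
Lemma additive_locally_bounded_linear (phi : R -> R) K :
  (forall s t, phi (s + t) = phi s + phi t) ->
  (forall t, 0 <= t <= 1 -> Rabs (phi t) <= K) ->
  forall t, phi t = t * phi 1.
Proof.
  intros Hadd HK.
  pose (chi := fun t => phi t - t * phi 1).
  assert (Hchi : forall s t, chi (s + t) = chi s + chi t).
  { intros s t. unfold chi. rewrite Hadd. ring. }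
  assert (H0 : chi 0 = 0) by (pose proof (Hchi 0 0) as H; rewrite Rplus_0_r in H; lra).
  assert (Hopp : forall t, chi (- t) = - chi t).
  { intros t. pose proof (Hchi t (- t)) as H. rewrite Rplus_opp_r in H. lra. }
  assert (Hnat : forall n t, chi (INR n * t) = INR n * chi t).
  { intros n t. induction n as [|n IH].
    - simpl. rewrite !Rmult_0_l. exact H0.
    - rewrite S_INR, Rmult_plus_distr_r, Rmult_1_l, Hchi, IH. ring. }
  assert (H1 : chi 1 = 0) by (unfold chi; lra).
  assert (HZ : forall k, chi (IZR k) = 0).
  { intros k. destruct k as [|p|p]; auto.
    - rewrite <- positive_nat_Z, <- INR_IZR_INZ, <- (Rmult_1_r (INR _)), Hnat, H1. ring.
    - rewrite <- Pos2Z.opp_pos, opp_IZR, Hopp.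
      rewrite <- positive_nat_Z, <- INR_IZR_INZ, <- (Rmult_1_r (INR _)), Hnat, H1. ring. }
  pose (M := K + Rabs (phi 1)).
  assert (HM : forall t, Rabs (chi t) <= M).
  { intros t. replace t with (IZR (Int_part t) + frac_part t) by (unfold frac_part; ring).
    destruct (base_fp t) as [Hf1 Hf2]. rewrite Hchi, HZ, Rplus_0_l. unfold chi.
    pose proof (HK (frac_part t) ltac:(lra)).
    pose proof (Rabs_triang (phi (frac_part t)) (- (frac_part t * phi 1))) as H2.
    rewrite Rabs_Ropp, Rabs_mult, (Rabs_pos_eq (frac_part t)) in H2 by lra.
    pose proof (Rabs_pos (phi 1)). unfold M, Rminus. nra. }
  intros t. assert (chi t = 0); [|unfold chi in *; lra].
  apply NNPP. intros Hne. apply Rabs_pos_lt in Hne.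
  destruct (INR_unbounded (M / Rabs (chi t))) as [n Hn].
  specialize (HM (INR n * t)). rewrite Hnat, Rabs_mult, (Rabs_pos_eq (INR n)) in HM
    by apply pos_INR.
  apply Rmult_lt_compat_r with (r := Rabs (chi t)) in Hn; auto.
  replace (M / Rabs (chi t) * Rabs (chi t)) with M in Hn by (field; lra). lra.
Qed.

(** [B] is the polarization of [q]. No continuity of [q] is assumed; real homogeneity comes from
    additivity and a bound for [0 <= t <= 1]. *)
Lemma jordan_von_neumann {X : Type} (q : (X -> R) -> R) :
  (forall u, bounded X u -> 0 <= q u) ->
  (forall a u, bounded X u -> q (fun x => a * u x) = a * a * q u) ->
  (forall u v, bounded X u -> bounded X v ->
    q (fun x => u x + v x) + q (fun x => u x - v x) = 2 * q u + 2 * q v) ->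
  exists B, bilinear_form X (bounded X) B /\ forall u, bounded X u -> B u u = q u.
Proof.
  intros Hpos Hscal Hpar.
  pose (B := fun u v : X -> R => (q (fun x => u x + v x) - q (fun x => u x - v x)) / 4).
  assert (Hopp : forall u, bounded X u -> q (fun x => - u x) = q u).
  { intros u Hu. replace (fun x => - u x) with (fun x => -1 * u x) by fext.
    rewrite Hscal; auto. ring. }
  assert (Hsym : forall u v, bounded X u -> bounded X v -> B u v = B v u).
  { intros u v Hu Hv. unfold B.
    rewrite <- (Hopp (fun x => u x - v x)) by now apply bounded_sub.
    replace (fun x => - (u x - v x)) with (fun x => v x - u x) by fext.
    replace (fun x => u x + v x) with (fun x => v x + u x) by fext. reflexivity. }
  assert (Hmid : forall u v w, bounded X u -> bounded X v -> bounded X w ->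
    B (fun x => u x + w x) v + B (fun x => u x - w x) v = 2 * B u v).
  { intros u v w Hu Hv Hw. unfold B.
    pose proof (Hpar _ _ (bounded_add u v Hu Hv) Hw) as P1.
    pose proof (Hpar _ _ (bounded_sub u v Hu Hv) Hw) as P2. cbv beta in P1, P2.
    replace (fun x => u x + w x + v x) with (fun x => u x + v x + w x) by fext.
    replace (fun x => u x - w x + v x) with (fun x => u x + v x - w x) by fext.
    replace (fun x => u x + w x - v x) with (fun x => u x - v x + w x) by fext.
    replace (fun x => u x - w x - v x) with (fun x => u x - v x - w x) by fext. lra. }
  assert (Hzero : forall v, bounded X v -> B (fun _ => 0) v = 0).
  { intros v Hv. unfold B. replace (fun x => 0 + v x) with v by fext.
    replace (fun x => 0 - v x) with (fun x => - v x) by fext. rewrite Hopp; auto. lra. }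
  assert (Hadd : forall u v w, bounded X u -> bounded X v -> bounded X w ->
    B (fun x => u x + v x) w = B u w + B v w).
  { intros u v w Hu Hv Hw.
    (* [Hmid] at [(s, d)] gives [B u w + B v w = 2 B s w], and at [(s, s)] it gives
       [B (u + v) w = 2 B s w]. *)
    pose (s := fun x => / 2 * (u x + v x)). pose (d := fun x => / 2 * (u x - v x)).
    assert (Hs : bounded X s) by (apply (bounded_scal _ (fun x => u x + v x)), bounded_add; auto).
    assert (Hd : bounded X d) by (apply (bounded_scal _ (fun x => u x - v x)), bounded_sub; auto).
    pose proof (Hmid s w d Hs Hw Hd) as M1. pose proof (Hmid s w s Hs Hw Hs) as M2.
    replace (fun x => s x + d x) with u in M1
      by (apply functional_extensionality; intro; unfold s, d; field).
    replace (fun x => s x - d x) with v in M1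
      by (apply functional_extensionality; intro; unfold s, d; field).
    replace (fun x => s x + s x) with (fun x => u x + v x) in M2
      by (apply functional_extensionality; intro; unfold s, d; field).
    replace (fun x => s x - s x) with (fun _ : X => 0) in M2
      by (apply functional_extensionality; intro; unfold s, d; field).
    rewrite Hzero in M2; auto. lra. }
  exists B. split; [split; [|split; [|split]]|]; auto.
  - intros a u w Hu Hw.
    replace (B u w) with (B (fun x => 1 * u x) w) by (f_equal; fext).
    apply (additive_locally_bounded_linear (fun t => B (fun x => t * u x) w)
      ((q u + q w) / 2)).
    + intros s t. rewrite <- Hadd; auto using bounded_scal. f_equal. fext.
    (* The difference of two nonnegative values of [q] is bounded by their sum, which the
       parallelogram law computes. *)
    + intros t Ht. unfold B.
      pose proof (bounded_scal t u Hu) as Htu.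
      pose proof (Hpar _ w Htu Hw) as P. cbv beta in P. rewrite Hscal in P; auto.
      pose proof (Hpos _ (bounded_add _ w Htu Hw)).
      pose proof (Hpos _ (bounded_sub _ w Htu Hw)). cbv beta in *.
      pose proof (Hpos u Hu). assert (t * t * q u <= 1 * q u) by (apply Rmult_le_compat_r; nra).
      apply Rabs_le. lra.
  - intros u Hu. unfold B.
    replace (fun x => u x - u x) with (fun x => 0 * u x) by fext.
    replace (fun x => u x + u x) with (fun x => 2 * u x) by fext.
    rewrite !Hscal; auto. pose proof (Hpos u Hu). lra.
  - intros u Hu. unfold B.
    replace (fun x => u x - u x) with (fun x => 0 * u x) by fext.
    replace (fun x => u x + u x) with (fun x => 2 * u x) by fext.
    rewrite !Hscal; auto. lra.
Qed.

(** * Regularization of the form *)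

Section Regularization.
Context {X : Type} {D : (X -> R) -> Prop} {E : (X -> R) -> (X -> R) -> R}.
Hypothesis HD : bounded_function_space X D.
Hypothesis HE : bilinear_form X D E.
Hypothesis HF : contractions_operate X D E.
Context {m : (X -> R) -> R}.
Hypothesis Hm : linear m.
Hypothesis Hpos : positive m.
Implicit Types u v w f g h : X -> R.

Definition reg_energy u g : R := E g g + m (fun x => (u x - g x) * (u x - g x)).

(* The Moreau-Yosida regularization of [E] in [L^2(m)]. *)
Definition reg u : R := Glb (fun r => exists g, D g /\ r = reg_energy u g).

Lemma bounded_sqr_diff u g : bounded X u -> D g ->
  bounded X (fun x => (u x - g x) * (u x - g x)).
Proof.
  intros Hu Hg. pose proof (bounded_sub _ _ Hu (space_bounded HD _ Hg)) as H.
  apply (bounded_mult _ _ H H).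
Qed.

Lemma reg_energy_ge0 u g : bounded X u -> D g -> 0 <= reg_energy u g.
Proof.
  intros Hu Hg. pose proof (form_ge0 HE g Hg).
  pose proof (Hpos _ (bounded_sqr_diff u g Hu Hg) (fun x => Rle_0_sqr _)).
  unfold reg_energy. lra.
Qed.

Lemma reg_is_glb u : bounded X u ->
  is_glb (fun r => exists g, D g /\ r = reg_energy u g) (reg u).
Proof.
  intros Hu. apply Glb_is_glb with (b := 0) (s := reg_energy u (fun _ => 0)).
  - exists (fun _ => 0). split; auto. apply (space_zero HD).
  - intros r (g & Hg & ->). now apply reg_energy_ge0.
Qed.

Lemma reg_le u g : bounded X u -> D g -> reg u <= reg_energy u g.
Proof. intros Hu Hg. apply (is_glb_le _ _ _ (reg_is_glb u Hu)). now exists g. Qed.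

Lemma reg_approx u e : bounded X u -> 0 < e -> exists g, D g /\ reg_energy u g < reg u + e.
Proof.
  intros Hu He. destruct (is_glb_approx _ _ e (reg_is_glb u Hu) He) as (r & (g & Hg & ->) & H).
  now exists g.
Qed.

Lemma reg_ge0 u : bounded X u -> 0 <= reg u.
Proof. intros Hu. apply (reg_is_glb u Hu). intros r (g & Hg & ->). now apply reg_energy_ge0. Qed.

Lemma reg_le_form u : D u -> reg u <= E u u.
Proof.
  intros Hu. pose proof (reg_le u u (space_bounded HD _ Hu) Hu) as H. unfold reg_energy in H.
  replace (fun x => (u x - u x) * (u x - u x)) with (fun x : X => 0 * 0) in H by fext.
  rewrite (proj2 Hm 0 (fun _ => 0)) in H by apply bounded_const. lra.
Qed.

(** The competitor [g = 0] has no energy. This is where sup-norm continuity is gained, with constant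
    [m 1]. *)
Lemma reg_le_sup u c : bounded X u -> (forall x, Rabs (u x) <= c) ->
  reg u <= m (fun _ => 1) * (c * c).
Proof.
  intros Hu Hc. pose proof (reg_le u _ Hu (space_zero HD)) as H. unfold reg_energy in H.
  rewrite (form_zerol HD HE) in H by apply (space_zero HD).
  rewrite Rmult_comm, <- (proj2 Hm) by apply bounded_const.
  apply Rle_trans with (1 := H). rewrite Rplus_0_l.
  apply (positive_le m _ _ Hm Hpos).
  - apply bounded_sqr_diff; auto. apply (space_zero HD).
  - apply bounded_const.
  - intros x. specialize (Hc x). apply Rabs_le_inv in Hc. nra.
Qed.

(** If [g] nearly minimizes for [u], then [F(g)] competes for [F(u)]: the energy decreases by
    assumption, and the penalty because [F] is 1-Lipschitz and [m] is positive. *)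
Lemma reg_contraction F u : normal_contraction F -> bounded X u ->
  reg (fun x => F (u x)) <= reg u.
Proof.
  intros HC Hu. apply (le_epsilon_mult 1). intros e [He _].
  destruct (reg_approx u e Hu He) as (g & Hg & H).
  destruct (HF F g HC Hg) as [HFg HE2].
  pose proof (reg_le _ _ (bounded_contraction F u HC Hu) HFg) as H1.
  assert (H2 : m (fun x => (F (u x) - F (g x)) * (F (u x) - F (g x)))
            <= m (fun x => (u x - g x) * (u x - g x))).
  { apply (positive_le m _ _ Hm Hpos).
    - apply (bounded_sqr_diff (fun x => F (u x)) (fun x => F (g x))); auto.
      now apply bounded_contraction.
    - now apply bounded_sqr_diff.
    - intros x. apply Rsqr_le_abs_1, HC. }
  unfold reg_energy in *. lra.
Qed.

Lemma reg_scal_le a u : bounded X u -> reg (fun x => a * u x) <= a * a * reg u.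
Proof.
  intros Hu. apply (le_epsilon_mult (a * a)). intros e [He _].
  destruct (reg_approx u e Hu He) as (g & Hg & H).
  pose proof (reg_le _ _ (bounded_scal a _ Hu) (space_scal HD a _ Hg)) as H1.
  unfold reg_energy in *. rewrite (quad_scal HD HE) in H1; auto.
  replace (fun x => (a * u x - a * g x) * (a * u x - a * g x))
    with (fun x => a * a * ((u x - g x) * (u x - g x))) in H1 by fext.
  rewrite (proj2 Hm (a * a) (fun x => (u x - g x) * (u x - g x))) in H1
    by now apply bounded_sqr_diff.
  assert (0 <= a * a) by apply Rle_0_sqr. nra.
Qed.

Lemma reg_scal a u : bounded X u -> reg (fun x => a * u x) = a * a * reg u.
Proof.
  intros Hu. apply Rle_antisym. now apply reg_scal_le.
  destruct (Req_dec a 0) as [->|Ha].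
  - rewrite !Rmult_0_l. apply reg_ge0. now apply bounded_scal.
  - pose proof (reg_scal_le (/ a) _ (bounded_scal a u Hu)) as H. cbv beta in H.
    replace (fun x => / a * (a * u x)) with u in H
      by (apply functional_extensionality; intro; now field).
    assert (H0 : 0 <= a * a) by apply Rle_0_sqr.
    apply Rmult_le_compat_l with (r := a * a) in H; auto.
    replace (a * a * (/ a * / a * reg (fun x => a * u x))) with (reg (fun x => a * u x)) in H
      by (field; auto). exact H.
Qed.

(** If [g] and [k] nearly minimize for [u] and [v], then [g + k] and [g - k] compete for [u + v] and
    [u - v], and both parts of the energy obey the parallelogram identity. *)
Lemma reg_parallelogram_le u v : bounded X u -> bounded X v ->
  reg (fun x => u x + v x) + reg (fun x => u x - v x) <= 2 * reg u + 2 * reg v.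
Proof.
  intros Hu Hv. apply (le_epsilon_mult 4). intros e [He _].
  destruct (reg_approx u e Hu He) as (g & Hg & H1).
  destruct (reg_approx v e Hv He) as (k & Hk & H2).
  pose proof (reg_le _ _ (bounded_add _ _ Hu Hv) (space_add HD _ _ Hg Hk)) as H3.
  pose proof (reg_le _ _ (bounded_sub _ _ Hu Hv) (space_sub HD _ _ Hg Hk)) as H4.
  pose proof (bounded_sqr_diff _ _ (bounded_add _ _ Hu Hv) (space_add HD _ _ Hg Hk)) as B3.
  pose proof (bounded_sqr_diff _ _ (bounded_sub _ _ Hu Hv) (space_sub HD _ _ Hg Hk)) as B4.
  pose proof (bounded_sqr_diff _ _ Hu Hg) as B1.
  pose proof (bounded_sqr_diff _ _ Hv Hk) as B2.
  pose proof (proj1 Hm _ _ B3 B4) as Hsum. cbv beta in Hsum.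
  replace (fun x => (u x + v x - (g x + k x)) * (u x + v x - (g x + k x)) +
                    (u x - v x - (g x - k x)) * (u x - v x - (g x - k x)))
    with (fun x => 2 * ((u x - g x) * (u x - g x)) + 2 * ((v x - k x) * (v x - k x)))
    in Hsum by fext.
  rewrite (proj1 Hm (fun x => 2 * ((u x - g x) * (u x - g x)))
    (fun x => 2 * ((v x - k x) * (v x - k x)))) in Hsum by now apply bounded_scal.
  rewrite (proj2 Hm 2 (fun x => (u x - g x) * (u x - g x))),
    (proj2 Hm 2 (fun x => (v x - k x) * (v x - k x))) in Hsum by assumption.
  unfold reg_energy in *.
  rewrite (quad_add HD HE) in H3; auto. rewrite (quad_sub HD HE) in H4; auto. lra.
Qed.

(** The reverse inequality is the previous one at [u + v] and [u - v], whose sum and difference are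
    [2 u] and [2 v]. *)
Lemma reg_parallelogram u v : bounded X u -> bounded X v ->
  reg (fun x => u x + v x) + reg (fun x => u x - v x) = 2 * reg u + 2 * reg v.
Proof.
  intros Hu Hv. apply Rle_antisym. now apply reg_parallelogram_le.
  pose proof (reg_parallelogram_le _ _ (bounded_add _ _ Hu Hv) (bounded_sub _ _ Hu Hv)) as H.
  cbv beta in H.
  replace (fun x => u x + v x + (u x - v x)) with (fun x => 2 * u x) in H by fext.
  replace (fun x => u x + v x - (u x - v x)) with (fun x => 2 * v x) in H by fext.
  rewrite !reg_scal in H; auto. lra.
Qed.

End Regularization.

(** [B] polarizes the regularization and [C] is [m 1]. The lower bound at the listed functions is
    the defining inequality of [m], read as a bound on the infimum over [g]. *)
Lemma form_approximation {X : Type} {D : (X -> R) -> Prop} {E : (X -> R) -> (X -> R) -> R}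
    (l : list (X -> R)) eps :
  inhabited X -> bounded_function_space X D -> bilinear_form X D E ->
  sup_norm_closable X D E -> contractions_operate X D E ->
  Forall D l -> 0 < eps ->
  exists B C, bilinear_form X (bounded X) B /\ contractions_operate X (bounded X) B /\
    (forall u c, bounded X u -> (forall x, Rabs (u x) <= c) -> B u u <= C * (c * c)) /\
    (forall f, D f -> B f f <= E f f) /\
    (forall f, In f l -> E f f - eps <= B f f).
Proof.
  intros HX HD HE Hclos HF Hl Heps.
  destruct (exists_common_measure HD HE Hclos l eps HX Hl Heps) as (m & Hm & Hpos & Hml).
  destruct (jordan_von_neumann (reg (D := D) (E := E) (m := m))) as (B & HB & HBq).
  - intros u Hu. now apply reg_ge0.
  - intros a u Hu. now apply reg_scal.
  - intros u v Hu Hv. now apply reg_parallelogram.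
  - exists B, (m (fun _ => 1)). split; [|split; [|split; [|split]]]; auto.
    + intros F u HC Hu. pose proof (bounded_contraction F u HC Hu). split; auto.
      rewrite !HBq by auto. now apply reg_contraction.
    + intros u c Hu Hc. rewrite HBq by auto. now apply reg_le_sup.
    + intros f Hf. rewrite HBq by now apply (space_bounded HD). now apply reg_le_form.
    + intros f Hf. assert (HDf : D f) by (rewrite Forall_forall in Hl; auto).
      pose proof (space_bounded HD f HDf) as Hb. rewrite HBq by auto.
      apply (reg_is_glb HD HE Hpos f Hb). intros r (g & Hg & ->). now apply Hml.
Qed.
(** * Sup-norm continuous forms on all bounded functions *)

Lemma sum_f_R0_scal a c N : sum_f_R0 (fun i => c * a i) N = c * sum_f_R0 a N.
Proof. rewrite scal_sum. apply sum_eq. intros. ring. Qed.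

Lemma sum_f_R0_swap (c : nat -> nat -> R) N M :
  sum_f_R0 (fun i => sum_f_R0 (c i) M) N = sum_f_R0 (fun j => sum_f_R0 (fun i => c i j) N) M.
Proof.
  induction M as [|M IH]; simpl. reflexivity.
  rewrite sum_plus, IH. reflexivity.
Qed.

Lemma sum_f_R0_symmetrize (c : nat -> nat -> R) N :
  sum_f_R0 (fun i => sum_f_R0 (c i) N) N =
  sum_f_R0 (fun i => sum_f_R0 (fun j => (c i j + c j i) / 2) N) N.
Proof.
  transitivity ((sum_f_R0 (fun i => sum_f_R0 (c i) N) N +
                 sum_f_R0 (fun j => sum_f_R0 (fun i => c i j) N) N) / 2).
  - rewrite <- sum_f_R0_swap. lra.
  - rewrite <- sum_plus. unfold Rdiv. rewrite Rmult_comm, <- sum_f_R0_scal.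
    apply sum_eq. intros i _. rewrite <- sum_plus, <- sum_f_R0_scal.
    apply sum_eq. intros j _. ring.
Qed.

Lemma sum_f_R0_delta (a : nat -> R) k N : (k <= N)%nat ->
  sum_f_R0 (fun i => a i * (if Nat.eq_dec k i then 1 else 0)) N = a k.
Proof.
  intros Hk. induction N as [|N IH]; simpl.
  - replace k with 0%nat by lia. simpl. ring.
  - destruct (Nat.eq_dec k (S N)) as [->|Hne].
    + rewrite (sum_eq _ (fun _ => 0)), sum_cte; [ring|].
      intros i Hi. destruct (Nat.eq_dec (S N) i); [lia|ring].
    + rewrite IH by lia. ring.
Qed.

Section BoundedForms.
Context {X : Type} {B : (X -> R) -> (X -> R) -> R} {C : R}.
Hypothesis HB : bilinear_form X (bounded X) B.
Hypothesis HF : contractions_operate X (bounded X) B.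
Hypothesis HC : forall u c, bounded X u -> (forall x, Rabs (u x) <= c) -> B u u <= C * (c * c).
Implicit Types u v f h : X -> R.

Let Hbd := bounded_function_space_bounded (X := X).

(** The arguments are first normalized to sup-norm at most 1, which restores the product bound that
    the arithmetic-mean estimate loses. *)
Lemma form_sup_bound u v a b : bounded X u -> bounded X v -> 0 < a -> 0 < b ->
  (forall x, Rabs (u x) <= a) -> (forall x, Rabs (v x) <= b) -> Rabs (B u v) <= C * (a * b).
Proof.
  intros Hu Hv Ha Hb Hua Hvb.
  assert (Hn : forall w c, 0 < c -> (forall x, Rabs (w x) <= c) ->
    forall x : X, Rabs (/ c * w x) <= 1).
  { intros w c Hc Hw x. rewrite Rabs_mult, Rabs_pos_eq
      by (left; now apply Rinv_0_lt_compat).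
    apply Rmult_le_reg_l with c; auto.
    rewrite <- Rmult_assoc, Rinv_r, Rmult_1_l, Rmult_1_r by lra. apply Hw. }
  pose proof (bounded_scal (/ a) u Hu) as Hu'. pose proof (bounded_scal (/ b) v Hv) as Hv'.
  pose proof (form_abs_le Hbd HB _ _ Hu' Hv') as H.
  pose proof (HC _ 1 Hu' (Hn u a Ha Hua)). pose proof (HC _ 1 Hv' (Hn v b Hb Hvb)).
  rewrite (form_scall HB), (form_scalr Hbd HB) in H; auto.
  assert (Hab : 0 < a * b) by nra.
  replace (B u v) with (a * b * (/ a * (/ b * B u v))) by (field; lra).
  rewrite Rabs_mult, (Rabs_pos_eq (a * b)) by lra.
  rewrite (Rmult_comm C). apply Rmult_le_compat_l; lra.
Qed.

(* The contraction [min(., 1)] maps [1 + t v] to [1]. *)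
Lemma form_one_ge0 v : bounded X v -> (forall x, 0 <= v x) -> 0 <= B v (fun _ => 1).
Proof.
  intros Hv Hv0. pose proof (bounded_const (X := X) 1) as H1.
  assert (Hmin : normal_contraction (fun y => Rmin y 1)).
  { split.
    - apply Rmin_left. lra.
    - intros x y. unfold Rmin. destruct (Rle_dec x 1), (Rle_dec y 1);
        unfold Rabs; repeat destruct Rcase_abs; lra. }
  pose proof (form_ge0 HB v Hv) as Hvv.
  apply (le_epsilon_mult (B v v)). intros t [Ht _].
  pose proof (bounded_scal (2 * t) v Hv) as Htv.
  destruct (HF _ (fun x => 2 * t * v x + 1) Hmin) as [_ H].
  { now apply bounded_add. }
  replace (fun x => Rmin (2 * t * v x + 1) 1) with (fun _ : X => 1) in H.
  2: { apply functional_extensionality. intro x. symmetry. apply Rmin_right.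
       specialize (Hv0 x). nra. }
  rewrite (quad_add Hbd HB (fun x => 2 * t * v x)), (quad_scal Hbd HB), (form_scall HB) in H;
    auto.
  assert (0 <= 4 * t * (B v (fun _ => 1) + B v v * t)) by nra.
  apply Rmult_le_reg_l with (4 * t); lra.
Qed.

(* The contraction [|.|] maps [u - v] to [u + v]. *)
Lemma form_disjoint_le0 u v : bounded X u -> bounded X v ->
  (forall x, 0 <= u x) -> (forall x, 0 <= v x) -> (forall x, u x * v x = 0) -> B u v <= 0.
Proof.
  intros Hu Hv Hu0 Hv0 Huv.
  assert (Habs : normal_contraction Rabs).
  { split. apply Rabs_R0. intros x y. apply Rabs_triang_inv2. }
  destruct (HF _ _ Habs (bounded_sub u v Hu Hv)) as [_ H].
  replace (fun x => Rabs (u x - v x)) with (fun x => u x + v x) in H.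
  - rewrite (quad_add Hbd HB), (quad_sub Hbd HB) in H; auto. lra.
  - apply functional_extensionality. intro x.
    specialize (Hu0 x). specialize (Hv0 x).
    destruct (Rmult_integral _ _ (Huv x)) as [->| ->].
    + rewrite Rabs_left1; lra.
    + rewrite Rabs_right; lra.
Qed.

(** * Step functions and the Beurling-Deny expression *)

Section StepFunctions.
Variables (k : X -> nat) (N : nat).
Hypothesis Hk : forall x, (k x <= N)%nat.

Let ind (i : nat) : X -> R := fun x => if Nat.eq_dec (k x) i then 1 else 0.
(** The finite partition is the labelling [k], with empty cells allowed. Writing a step function as
    a composition with [k] makes products and contractions act on coefficients by conversion. *)
Let step (a : nat -> R) : X -> R := fun x => a (k x).

Lemma bounded_comp_step a : bounded X (step a).
Proof.
  exists (sum_f_R0 (fun i => Rabs (a i)) N). intros x. unfold step.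
  rewrite <- (sum_f_R0_delta (fun i => Rabs (a i)) (k x) N (Hk x)).
  apply sum_Rle. intros i _. pose proof (Rabs_pos (a i)).
  destruct (Nat.eq_dec (k x) i); lra.
Qed.

Lemma bounded_ind i : bounded X (ind i).
Proof. apply (bounded_comp_step (fun j => if Nat.eq_dec j i then 1 else 0)). Qed.

Lemma step_sum_ind a : step a = fun x => sum_f_R0 (fun i => a i * ind i x) N.
Proof. apply functional_extensionality. intro x. symmetry. now apply sum_f_R0_delta. Qed.

Lemma form_suml a v M : bounded X v ->
  bounded X (fun x => sum_f_R0 (fun i => a i * ind i x) M) /\
  B (fun x => sum_f_R0 (fun i => a i * ind i x) M) v = sum_f_R0 (fun i => a i * B (ind i) v) M.
Proof.
  intros Hv. induction M as [|M [IHb IH]]; simpl.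
  - pose proof (bounded_ind 0). split. now apply bounded_scal. now apply (form_scall HB).
  - pose proof (bounded_ind (S M)) as Hi. pose proof (bounded_scal (a (S M)) _ Hi) as Hs. split.
    + now apply (bounded_add (fun x => sum_f_R0 (fun i => a i * ind i x) M)).
    + rewrite (form_addl HB (fun x => sum_f_R0 (fun i => a i * ind i x) M)); auto.
      rewrite IH, (form_scall HB); auto.
Qed.

Lemma form_stepl a v : bounded X v -> B (step a) v = sum_f_R0 (fun i => a i * B (ind i) v) N.
Proof. intros Hv. rewrite step_sum_ind. now apply form_suml. Qed.

Lemma form_step a b :
  B (step a) (step b) = sum_f_R0 (fun i => sum_f_R0 (fun j => a i * b j * B (ind i) (ind j)) N) N.
Proof.
  rewrite form_stepl by apply bounded_comp_step. apply sum_eq. intros i _.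
  rewrite (form_sym HB); auto using bounded_ind, bounded_comp_step.
  rewrite form_stepl, <- sum_f_R0_scal by apply bounded_ind.
  apply sum_eq. intros j _. rewrite (form_sym HB (ind j)) by apply bounded_ind. ring.
Qed.

(* Beurling-Deny decomposition into a jump part and a killing part. *)
Lemma Lf_step a b :
  Lf B (step a) (step b) =
  sum_f_R0 (fun i => sum_f_R0 (fun j =>
    - (B (ind i) (ind j) / 2) * ((a i - a j) * (a i - a j) * (b i + b j))) N) N
  + sum_f_R0 (fun i => a i * a i * b i * B (ind i) (fun _ => 1)) N.
Proof.
  assert (H1 : forall i, B (ind i) (fun _ => 1) = sum_f_R0 (fun j => B (ind i) (ind j)) N).
  { intros i. pose proof (bounded_ind i) as Hi.
    rewrite (form_sym HB); auto using bounded_const.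
    change (fun _ : X => 1) with (step (fun _ => 1)).
    rewrite form_stepl; auto. apply sum_eq. intros j _.
    rewrite (form_sym HB); auto using bounded_ind. ring. }
  unfold Lf.
  change (fun x => step a x * step b x) with (step (fun i => a i * b i)).
  change (fun x => step a x * step a x) with (step (fun i => a i * a i)).
  rewrite !form_step, <- sum_f_R0_scal.
  rewrite (sum_eq (fun i => a i * a i * b i * B (ind i) (fun _ => 1))
    (fun i => sum_f_R0 (fun j => a i * a i * b i * B (ind i) (ind j)) N)).
  2: { intros i _. now rewrite H1, sum_f_R0_scal. }
  rewrite <- minus_sum, <- sum_plus.
  rewrite (sum_eq _ (fun i => sum_f_R0 (fun j =>
    (2 * (a i * b i * a j) - a i * a i * b j) * B (ind i) (ind j)) N)).
  2: { intros i _. rewrite <- sum_f_R0_scal, <- minus_sum. apply sum_eq. intros j _. ring. }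
  rewrite (sum_eq (fun i => _ + _) (fun i => sum_f_R0 (fun j =>
    - (B (ind i) (ind j) / 2) * ((a i - a j) * (a i - a j) * (b i + b j))
    + a i * a i * b i * B (ind i) (ind j)) N)).
  2: { intros i _. now rewrite <- sum_plus. }
  (* The summands of the two sides agree only after averaging over the exchange of [i] and [j]. *)
  rewrite sum_f_R0_symmetrize. symmetry. rewrite sum_f_R0_symmetrize.
  apply sum_eq. intros i _. apply sum_eq. intros j _.
  rewrite (form_sym HB (ind j) (ind i)) by apply bounded_ind. field.
Qed.

(** The comparison is termwise: a contraction shrinks [|a i - a j|] and [|a i|], and the
    coefficients are nonnegative, off the diagonal by [form_disjoint_le0] and in the killing part by
    [form_one_ge0]. *)
Lemma Lf_step_contraction F a b : normal_contraction F -> (forall i, 0 <= b i) ->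
  Lf B (step (fun i => F (a i))) (step b) <= Lf B (step a) (step b).
Proof.
  intros HFc Hb. rewrite !Lf_step. apply Rplus_le_compat.
  - apply sum_Rle. intros i _. apply sum_Rle. intros j _.
    (* On the diagonal the coefficient has the wrong sign, but it multiplies zero. *)
    destruct (Nat.eq_dec i j) as [->|Hij]. lra.
    apply Rmult_le_compat_l.
    + assert (B (ind i) (ind j) <= 0); [|lra].
      apply form_disjoint_le0; auto using bounded_ind; intros x; unfold ind.
      * destruct (Nat.eq_dec (k x) i); lra.
      * destruct (Nat.eq_dec (k x) j); lra.
      * destruct (Nat.eq_dec (k x) i), (Nat.eq_dec (k x) j); try lra. congruence.
    + apply Rmult_le_compat_r.
      * pose proof (Hb i). pose proof (Hb j). lra.
      * apply Rsqr_le_abs_1, HFc.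
  - apply sum_Rle. intros i _. apply Rmult_le_compat_r.
    + apply form_one_ge0. apply bounded_ind. intros x. unfold ind.
      destruct (Nat.eq_dec (k x) i); lra.
    + apply Rmult_le_compat_r. apply Hb.
      apply Rsqr_le_abs_1. now apply normal_contraction_abs.
Qed.

End StepFunctions.

(** * Approximation of bounded functions by step functions *)

(** Rounding down on a grid of mesh [e] that starts at [c]. Keeping the lower bound [c] gives
    nonnegative coefficients to a nonnegative function. *)
Lemma step_approximation f c e : bounded X f -> (forall x, c <= f x) -> 0 < e ->
  exists (k : X -> nat) N a, (forall x, (k x <= N)%nat) /\
    (forall x, Rabs (f x - a (k x)) <= e) /\ (forall i : nat, c <= a i).
Proof.
  intros [M HM] Hc He.
  pose (y := fun x => (f x - c) / e).
  assert (Hy : forall x, y x * e = f x - c) by (intros; unfold y; field; lra).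
  assert (Hk : forall x, exists n, INR n <= y x <= INR n + 1).
  { intros x. assert (Hy0 : 0 <= y x).
    { apply Rmult_le_pos. specialize (Hc x). lra. left. now apply Rinv_0_lt_compat. }
    destruct (base_Int_part (y x)) as [H1 H2].
    assert (HZ : (0 <= Int_part (y x))%Z).
    { assert (H : (-1 < Int_part (y x))%Z) by (apply lt_IZR; lra). lia. }
    exists (Z.to_nat (Int_part (y x))). rewrite INR_IZR_INZ, Z2Nat.id by exact HZ. lra. }
  apply choice in Hk. destruct Hk as [k Hk].
  destruct (INR_unbounded ((M - c) / e)) as [N HN].
  exists k, N, (fun i => c + INR i * e). split; [|split].
  - intros x. apply INR_le. apply Rle_trans with (y x). apply Hk.
    apply Rle_trans with ((M - c) / e); [|lra].
    apply Rmult_le_compat_r. left. now apply Rinv_0_lt_compat.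
    specialize (HM x). apply Rabs_le_inv in HM. lra.
  - intros x. specialize (Hy x). specialize (Hk x). apply Rabs_le. nra.
  - intros i. pose proof (pos_INR i). nra.
Qed.

(** The two labels are coded as one number in base [S N2], which exceeds every label of [h], and
    decoded by quotient and remainder. *)
Lemma common_step_approximation f h e : bounded X f -> bounded X h ->
  (forall x, 0 <= h x) -> 0 < e ->
  exists (k : X -> nat) N a b, (forall x, (k x <= N)%nat) /\
    (forall x, Rabs (f x - a (k x)) <= e) /\ (forall x, Rabs (h x - b (k x)) <= e) /\
    (forall i : nat, 0 <= b i).
Proof.
  intros Hf Hh Hh0 He.
  assert (Hf' := Hf). destruct Hf' as [M HM].
  destruct (step_approximation f (- M) e) as (k1 & N1 & a & Hk1 & Ha & _); auto.
  { intros x. specialize (HM x). apply Rabs_le_inv in HM. lra. }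
  destruct (step_approximation h 0 e) as (k2 & N2 & b & Hk2 & Hb & Hb0); auto.
  pose (k := fun x => (k1 x * S N2 + k2 x)%nat).
  assert (Hdiv : forall x, (k x / S N2)%nat = k1 x).
  { intros x. symmetry. apply (Nat.div_unique _ _ _ (k2 x)). specialize (Hk2 x). lia.
    unfold k. lia. }
  assert (Hmod : forall x, (k x mod S N2)%nat = k2 x).
  { intros x. symmetry. apply (Nat.mod_unique _ _ (k1 x)). specialize (Hk2 x). lia.
    unfold k. lia. }
  exists k, (N1 * S N2 + N2)%nat, (fun n => a (n / S N2)%nat), (fun n => b (n mod S N2)%nat).
  split; [|split; [|split]].
  - intros x. unfold k. specialize (Hk1 x). specialize (Hk2 x).
    apply Nat.add_le_mono; auto. now apply Nat.mul_le_mono_r.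
  - intros x. rewrite Hdiv. apply Ha.
  - intros x. rewrite Hmod. apply Hb.
  - intros i. apply Hb0.
Qed.

(** * Continuity estimates and passage to all bounded functions *)

Lemma Rabs_mult_sub_le x y x' y' M e : Rabs x <= M -> Rabs y' <= M ->
  Rabs (x - x') <= e -> Rabs (y - y') <= e -> Rabs (x * y - x' * y') <= 2 * M * e.
Proof.
  intros Hx Hy Hxx Hyy.
  replace (x * y - x' * y') with (x * (y - y') + (x - x') * y') by ring.
  apply Rle_trans with (1 := Rabs_triang _ _). rewrite !Rabs_mult.
  pose proof (Rabs_pos x). pose proof (Rabs_pos y').
  pose proof (Rabs_pos (x - x')). pose proof (Rabs_pos (y - y')). nra.
Qed.

Lemma form_diff_le u v u' v' M M' e e' :
  bounded X u -> bounded X v -> bounded X u' -> bounded X v' ->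
  0 < M -> 0 < M' -> 0 < e -> 0 < e' ->
  (forall x, Rabs (u' x) <= M) -> (forall x, Rabs (v x) <= M') ->
  (forall x, Rabs (u x - u' x) <= e) -> (forall x, Rabs (v x - v' x) <= e') ->
  Rabs (B u v - B u' v') <= C * (e * M') + C * (M * e').
Proof.
  intros Hu Hv Hu' Hv' HM HM' He He' HuM HvM Huu Hvv.
  replace (B u v - B u' v') with (B (fun x => u x - u' x) v + B u' (fun x => v x - v' x)).
  2: { rewrite (form_subl Hbd HB), (form_subr Hbd HB); auto. ring. }
  apply Rle_trans with (1 := Rabs_triang _ _).
  apply Rplus_le_compat; apply form_sup_bound; auto using bounded_sub.
Qed.

(** A product varies by at most [2 M e], so each mixed value of [B] varies by at most [3 C M^2 e];
    the weights 2 and 1 in [L_f] add up to the constant 9. *)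
Lemma Lf_continuous f h f' h' M e :
  bounded X f -> bounded X h -> bounded X f' -> bounded X h' -> 0 < M -> 0 < e ->
  (forall x, Rabs (f x) <= M) -> (forall x, Rabs (h x) <= M) ->
  (forall x, Rabs (f' x) <= M) -> (forall x, Rabs (h' x) <= M) ->
  (forall x, Rabs (f x - f' x) <= e) -> (forall x, Rabs (h x - h' x) <= e) ->
  Rabs (Lf B f h - Lf B f' h') <= 9 * C * (M * M) * e.
Proof.
  intros Hf Hh Hf' Hh' HM He HfM HhM HfM' HhM' Hff Hhh.
  assert (Hprod : forall u v : X -> R, (forall x, Rabs (u x) <= M) ->
    (forall x, Rabs (v x) <= M) -> forall x, Rabs (u x * v x) <= M * M).
  { intros u v HuM HvM x. rewrite Rabs_mult. apply Rmult_le_compat; auto using Rabs_pos. }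
  assert (HMM : 0 < M * M) by nra. assert (HMe : 0 < 2 * M * e) by nra.
  assert (D1 : Rabs (B (fun x => f x * h x) f - B (fun x => f' x * h' x) f')
            <= C * (2 * M * e * M) + C * (M * M * e)).
  { apply form_diff_le; auto using bounded_mult.
    intros x. now apply Rabs_mult_sub_le. }
  assert (D2 : Rabs (B (fun x => f x * f x) h - B (fun x => f' x * f' x) h')
            <= C * (2 * M * e * M) + C * (M * M * e)).
  { apply form_diff_le; auto using bounded_mult.
    intros x. now apply Rabs_mult_sub_le. }
  apply Rabs_le_inv in D1, D2. unfold Lf. apply Rabs_le. lra.
Qed.

Lemma Lf_bounded_contraction F f h : normal_contraction F -> bounded X f -> bounded X h ->
  (forall x, 0 <= h x) -> Lf B (fun x => F (f x)) h <= Lf B f h.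
Proof.
  intros HFc Hf Hh Hh0.
  destruct (bounded_pos_bound f Hf) as (M1 & HM1 & HfM).
  destruct (bounded_pos_bound h Hh) as (M2 & HM2 & HhM).
  (* The summand 1 leaves room for the step functions, which are within [e < 1] of [f] and [h]. *)
  pose (M := M1 + M2 + 1).
  apply (le_epsilon_mult (18 * C * (M * M))). intros e [He He1].
  destruct (common_step_approximation f h e Hf Hh Hh0 He) as (k & N & a & b & Hk & Ha & Hb & Hb0).
  pose proof (Lf_step_contraction k N Hk F a b HFc Hb0) as Hstep. cbv beta in Hstep.
  assert (Hnear : forall s t m, Rabs s <= m -> m + 1 <= M -> Rabs (s - t) <= e -> Rabs t <= M).
  { intros s t m Hs Hm Hst. apply Rabs_le_inv in Hs, Hst. apply Rabs_le. lra. }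
  assert (HfM' : forall x, Rabs (f x) <= M) by (intros x; specialize (HfM x); unfold M; lra).
  assert (HhM' : forall x, Rabs (h x) <= M) by (intros x; specialize (HhM x); unfold M; lra).
  assert (HaM : forall x, Rabs (a (k x)) <= M)
    by (intros x; apply (Hnear (f x) _ M1); auto; unfold M; lra).
  assert (HbM : forall x, Rabs (b (k x)) <= M)
    by (intros x; apply (Hnear (h x) _ M2); auto; unfold M; lra).
  pose proof (bounded_comp_step k N Hk a) as Hba.
  pose proof (bounded_comp_step k N Hk b) as Hbb.
  assert (HM : 0 < M) by (unfold M; lra).
  pose proof (Lf_continuous f h _ _ M e Hf Hh Hba Hbb HM He HfM' HhM' HaM HbM Ha Hb) as C1.
  assert (HFM : forall y, Rabs y <= M -> Rabs (F y) <= M).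
  { intros y Hy. apply Rle_trans with (Rabs y); auto. now apply normal_contraction_abs. }
  (* Since [F] is 1-Lipschitz, composing it with the step function for [f] approximates [F(f)] with
     the same error. *)
  assert (C2 : Rabs (Lf B (fun x => F (f x)) h - Lf B (fun x => F (a (k x))) (fun x => b (k x)))
            <= 9 * C * (M * M) * e).
  { apply Lf_continuous; auto using bounded_contraction.
    intros x. apply Rle_trans with (2 := Ha x). apply HFc. }
  apply Rabs_le_inv in C1, C2. lra.
Qed.

(** Positivity is the contraction inequality for [F = 0], where the left-hand functional
    vanishes. *)
Lemma Lf_bounded_nonneg f h : bounded X f -> bounded X h ->
  (forall x, 0 <= h x) -> 0 <= Lf B f h.
Proof.
  intros Hf Hh Hh0.
  assert (H0 : normal_contraction (fun _ => 0)).
  { split; auto. intros x y. rewrite Rminus_diag, Rabs_R0. apply Rabs_pos. }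
  pose proof (Lf_bounded_contraction _ f h H0 Hf Hh Hh0) as H. unfold Lf at 1 in H.
  replace (fun x => 0 * h x) with (fun _ : X => 0) in H by fext.
  replace (fun x : X => 0 * 0) with (fun _ : X => 0) in H by fext.
  rewrite !(form_zerol Hbd HB) in H; auto using bounded_const. lra.
Qed.

Lemma Lf_add f u v : bounded X f -> bounded X u -> bounded X v ->
  Lf B f (fun x => u x + v x) = Lf B f u + Lf B f v.
Proof.
  intros Hf Hu Hv. unfold Lf.
  replace (fun x => f x * (u x + v x)) with (fun x => f x * u x + f x * v x) by fext.
  rewrite (form_addl HB (fun x => f x * u x) (fun x => f x * v x)), (form_addr Hbd HB);
    auto using bounded_mult. ring.
Qed.

(* Positivity tested on [1 - h] and [1 + h], where [L_f(1) = 2 B(f,f) - B(f^2,1)]. *)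
Lemma Lf_bounded_norm f h : bounded X f -> bounded X h ->
  (forall x, Rabs (h x) <= 1) -> Rabs (Lf B f h) <= 2 * B f f.
Proof.
  intros Hf Hh Hh1.
  pose proof (bounded_const (X := X) 1) as H1.
  assert (Hone : Lf B f (fun _ => 1) <= 2 * B f f).
  { unfold Lf. replace (fun x => f x * 1) with f by fext.
    pose proof (form_one_ge0 _ (bounded_mult _ _ Hf Hf) (fun x => Rle_0_sqr _)). lra. }
  assert (Hplus : 0 <= Lf B f (fun x => 1 + h x)).
  { apply Lf_bounded_nonneg; auto using bounded_add. intros x.
    specialize (Hh1 x). apply Rabs_le_inv in Hh1. lra. }
  assert (Hminus : 0 <= Lf B f (fun x => 1 - h x)).
  { apply Lf_bounded_nonneg; auto using bounded_sub. intros x.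
    specialize (Hh1 x). apply Rabs_le_inv in Hh1. lra. }
  assert (Hsplit : Lf B f (fun _ => 1) = Lf B f (fun x => 1 - h x) + Lf B f h).
  { rewrite <- Lf_add; auto using bounded_sub. f_equal. fext. }
  rewrite (Lf_add f (fun _ => 1)) in Hplus; auto.
  apply Rabs_le. lra.
Qed.

End BoundedForms.
(** * Transfer to the form *)

(** On the range of [f] the square agrees with [2 M] times the map that truncates to [[-M, M]],
    squares and divides by [2 M]. That map is a normal contraction, since the square has slope at
    most [2 M] there. *)
Lemma space_square {X : Type} {D : (X -> R) -> Prop} {E : (X -> R) -> (X -> R) -> R} f :
  bounded_function_space X D -> contractions_operate X D E -> D f ->
  D (fun x => f x * f x).
Proof.
  intros HD HF Hf.
  destruct (bounded_pos_bound f (space_bounded HD f Hf)) as (M & HM & HfM).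
  pose (c := fun y => Rmax (- M) (Rmin y M)).
  assert (Hc : forall y, Rabs (c y) <= M).
  { intros y. apply Rabs_le. unfold c, Rmax, Rmin.
    destruct (Rle_dec y M), (Rle_dec (- M) _); lra. }
  assert (HcL : forall x y, Rabs (c x - c y) <= Rabs (x - y)).
  { intros x y. unfold c, Rmax, Rmin.
    destruct (Rle_dec x M), (Rle_dec y M); repeat destruct (Rle_dec (- M) _);
      unfold Rabs; repeat destruct Rcase_abs; lra. }
  assert (Hn : normal_contraction (fun y => / (2 * M) * (c y * c y))).
  { split.
    - replace (c 0) with 0. ring. unfold c. rewrite Rmin_left, Rmax_right; lra.
    - intros x y.
      replace (/ (2 * M) * (c x * c x) - / (2 * M) * (c y * c y))
        with (/ (2 * M) * ((c x + c y) * (c x - c y))) by ring.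
      rewrite !Rabs_mult, Rabs_pos_eq by (left; apply Rinv_0_lt_compat; lra).
      apply Rmult_le_reg_l with (2 * M). lra.
      rewrite <- Rmult_assoc, Rinv_r, Rmult_1_l by lra.
      apply Rmult_le_compat; auto using Rabs_pos.
      apply Rle_trans with (1 := Rabs_triang _ _).
      pose proof (Hc x). pose proof (Hc y). lra. }
  pose proof (space_scal HD (2 * M) _ (proj1 (HF _ f Hn Hf))) as H. cbv beta in H.
  replace (fun x => f x * f x) with (fun x => 2 * M * (/ (2 * M) * (c (f x) * c (f x)))); auto.
  apply functional_extensionality. intro x. specialize (HfM x). apply Rabs_le_inv in HfM.
  replace (c (f x)) with (f x). field. lra.
  unfold c. rewrite Rmin_left, Rmax_right; lra.
Qed.

Lemma space_mult {X : Type} {D : (X -> R) -> Prop} {E : (X -> R) -> (X -> R) -> R} f h :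
  bounded_function_space X D -> contractions_operate X D E -> D f -> D h ->
  D (fun x => f x * h x).
Proof.
  intros HD HF Hf Hh.
  replace (fun x => f x * h x)
    with (fun x => / 2 * ((f x + h x) * (f x + h x) - (f x * f x + h x * h x)))
    by (apply functional_extensionality; intro; field).
  apply (space_scal HD (/ 2) (fun x => (f x + h x) * (f x + h x) - (f x * f x + h x * h x))).
  apply (space_sub HD (fun x => (f x + h x) * (f x + h x)) (fun x => f x * f x + h x * h x)).
  - apply (space_square _ HD HF). now apply (space_add HD).
  - apply (space_add HD (fun x => f x * f x) (fun x => h x * h x));
      now apply (space_square _ HD HF).
Qed.

(** The functions at which [L_f(h)] evaluates the form, hence those at which the approximation must
    be accurate. *)
Definition Lf_args {X : Type} (f h : X -> R) : list (X -> R) :=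
  (fun x => f x * h x) :: f :: (fun x => f x * f x) :: h :: nil.

Lemma Lf_args_in_space {X : Type} {D : (X -> R) -> Prop} {E : (X -> R) -> (X -> R) -> R} f h :
  bounded_function_space X D -> contractions_operate X D E -> D f -> D h ->
  Forall D (Lf_args f h).
Proof.
  intros HD HF Hf Hh. repeat constructor; auto; now apply (space_mult (E := E)).
Qed.

(* [E - B] is a nonnegative form that is at most [eps] on the four arguments. *)
Lemma Lf_transfer {X : Type} {D : (X -> R) -> Prop} {E B : (X -> R) -> (X -> R) -> R} f h eps :
  bounded_function_space X D -> bilinear_form X D E -> bilinear_form X (bounded X) B ->
  (forall u, D u -> B u u <= E u u) ->
  Forall D (Lf_args f h) -> (forall u, In u (Lf_args f h) -> E u u - eps <= B u u) ->
  Rabs (Lf E f h - Lf B f h) <= 3 * eps.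
Proof.
  intros HD HE HB HBE HDl Happ.
  assert (HR : bilinear_form X D (fun u v => E u v - B u v)).
  { pose proof (space_bounded HD) as Hb. split; [|split; [|split]].
    - intros u v Hu Hv. rewrite (form_sym HE), (form_sym HB); auto.
    - intros u v w Hu Hv Hw. rewrite (form_addl HE), (form_addl HB); auto. ring.
    - intros a u w Hu Hw. rewrite (form_scall HE), (form_scall HB); auto. ring.
    - intros u Hu. specialize (HBE u Hu). lra. }
  rewrite Forall_forall in HDl.
  assert (Hd : forall u v, In u (Lf_args f h) -> In v (Lf_args f h) ->
    Rabs (E u v - B u v) <= eps).
  { intros u v Hu Hv. pose proof (form_abs_le HD HR u v (HDl u Hu) (HDl v Hv)) as H.
    cbv beta in H. pose proof (Happ u Hu). pose proof (Happ v Hv). lra. }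
  pose proof (Hd (fun x => f x * h x) f ltac:(simpl; tauto) ltac:(simpl; tauto)) as H1.
  pose proof (Hd (fun x => f x * f x) h ltac:(simpl; tauto) ltac:(simpl; tauto)) as H2.
  apply Rabs_le_inv in H1, H2. unfold Lf. apply Rabs_le. lra.
Qed.

Theorem theoremT (X : Type) (D : (X -> R) -> Prop) (E : (X -> R) -> (X -> R) -> R) :
  inhabited X ->
  bounded_function_space X D ->
  C1c_stable D ->
  bilinear_form X D E ->
  sup_norm_closable X D E ->
  contractions_operate X D E ->
  forall f, D f ->
    (forall h, D h -> (forall x, 0 <= h x) -> 0 <= Lf E f h) /\
    (forall h, D h -> (forall x, Rabs (h x) <= 1) -> Rabs (Lf E f h) <= 2 * E f f) /\
    (forall F, normal_contraction F ->
       forall h, D h -> (forall x, 0 <= h x) ->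
         Lf E f h - Lf E (fun x => F (f x)) h >= 0).
Proof.
  intros HX HD _ HE Hclos HF f Hf.
  split; [|split].
  - intros h Hh Hh0. apply (le_epsilon_mult 3). intros eps [Heps _].
    pose proof (Lf_args_in_space f h HD HF Hf Hh) as Hl.
    destruct (form_approximation (Lf_args f h) eps HX HD HE Hclos HF Hl Heps)
      as (B & C & HB & HBF & HC & HBE & Happ).
    pose proof (Lf_transfer f h eps HD HE HB HBE Hl Happ) as H. apply Rabs_le_inv in H.
    pose proof (Lf_bounded_nonneg HB HBF HC f h (space_bounded HD f Hf)
      (space_bounded HD h Hh) Hh0). lra.
  - intros h Hh Hh1. apply (le_epsilon_mult 3). intros eps [Heps _].
    pose proof (Lf_args_in_space f h HD HF Hf Hh) as Hl.
    destruct (form_approximation (Lf_args f h) eps HX HD HE Hclos HF Hl Heps)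
      as (B & C & HB & HBF & HC & HBE & Happ).
    pose proof (Lf_transfer f h eps HD HE HB HBE Hl Happ) as H. apply Rabs_le_inv in H.
    pose proof (Lf_bounded_norm HB HBF HC f h (space_bounded HD f Hf)
      (space_bounded HD h Hh) Hh1) as H1. apply Rabs_le_inv in H1.
    (* Because [B] lies below [E] on [D], replacing [2 B f f] by [2 E f f] costs no error. *)
    specialize (HBE f Hf). apply Rabs_le. lra.
  - intros F HFc h Hh Hh0. apply Rle_ge, (le_epsilon_mult 6). intros eps [Heps _].
    pose proof (Lf_args_in_space f h HD HF Hf Hh) as Hl.
    pose proof (Lf_args_in_space _ h HD HF (proj1 (HF F f HFc Hf)) Hh) as HlF.
    (* The lists for [f] and [F(f)] are joined because the comparison needs one [B] for both
       functionals; the two transfers cost [3 eps] each. *)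
    destruct (form_approximation _ eps HX HD HE Hclos HF
        (proj2 (Forall_app _ _ _) (conj Hl HlF)) Heps)
      as (B & C & HB & HBF & HC & HBE & Happ).
    pose proof (Lf_transfer f h eps HD HE HB HBE Hl
      (fun u Hu => Happ u (in_or_app _ _ _ (or_introl Hu)))) as H1.
    pose proof (Lf_transfer _ h eps HD HE HB HBE HlF
      (fun u Hu => Happ u (in_or_app _ _ _ (or_intror Hu)))) as H2.
    apply Rabs_le_inv in H1, H2.
    pose proof (Lf_bounded_contraction HB HBF HC F f h HFc (space_bounded HD f Hf)
      (space_bounded HD h Hh) Hh0). lra.
Qed.
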